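(* Let $n \ge 1$ be an integer and let $p_0, p_1, \dotsc, p_{n-1}$ be positive integers. Then there exists an $n$-dimensional rational polytopal ball $Q_\ast \subset \mathbb{R}^n$ such that, for each $0 \le i \le n-1$, the coefficient function of $t^i$ in the Ehrhart quasi-polynomial $\mathrm{ehr}_{Q_\ast}(t)$ has minimum period $p_i$.
   Context: A rational polytopal ball (not-necessarily-convex rational polytope) in $\mathbb{R}^n$ is a topological ball that is a union $\bigcup_{j \in J} \mathcal{P}_j$ of a finite family of convex rational polytopes (vertices with rational coordinates), all with the same affine span, such that every nonempty intersection $\mathcal{P}_j \cap \mathcal{P}_{j'}$ with $j \ne j'$ is a common facet of $\mathcal{P}_j$ and $\mathcal{P}_{j'}$. For such an $n$-dimensional $Q \subset \mathbb{R}^n$, the Ehrhart function $\mathrm{ehr}_Q(k) = |kQ \cap \mathbb{Z}^n|$ for integers $k \ge 1$ is a quasi-polynomial $\sum_{i=0}^n c_i(k) k^i$ with uniquely determined periodic coefficient functions $c_i \colon \mathbb{Z} \to \mathbb{Q}$; the period of $c_i$ means the minimum positive integer $p$ with $c_i(k+p) = c_i(k)$ for all $k \in \mathbb{Z}$. *)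

(* Defs.v *)
From mathcomp Require Import all_boot all_order all_algebra.
From mathcomp Require Import finmap.
From mathcomp Require Import all_classical all_reals all_analysis.

Set Implicit Arguments.
Unset Strict Implicit.
Unset Printing Implicit Defensive.

Import Order.TTheory GRing.Theory Num.Theory.
Import numFieldNormedType.Exports.

Local Open Scope classical_set_scope.
Local Open Scope ring_scope.

Section Polytopes.
Context {R : realType} {n : nat}.
Implicit Types (A P F Q : set 'rV[R]_n) (d : nat).

Definition convex_hull A : set 'rV[R]_n :=
  [set x | exists (k : nat) (v : 'I_k -> 'rV[R]_n) (l : 'I_k -> R),
     [/\ forall i, A (v i), forall i, 0 <= l i,
         \sum_i l i = 1 & x = \sum_i l i *: v i]].

Definition affine_span A : set 'rV[R]_n :=
  [set x | exists (k : nat) (v : 'I_k -> 'rV[R]_n) (l : 'I_k -> R),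
     [/\ forall i, A (v i), \sum_i l i = 1 & x = \sum_i l i *: v i]].

(* The affine span of A is a translate of the row space of a d x n matrix of
   rank d. In particular A is nonempty: the empty set has no dimension here. *)
Definition has_dim A d : Prop :=
  exists (x0 : 'rV[R]_n) (B : 'M[R]_(d, n)),
    row_free B /\ affine_span A = [set x0 + u *m B | u in [set: 'rV[R]_d]].

Definition rational_polytope P : Prop :=
  exists V : set 'rV[R]_n,
    [/\ finite_set V, V `<=` range (map_mx (@ratr R) : 'rV[rat]_n -> 'rV[R]_n)
      & P = convex_hull V].

(* Exposed faces; a = 0 yields the improper faces (P itself and set0). *)
Definition is_face F P : Prop :=
  exists (a : 'rV[R]_n) (b : R),
    (forall x, P x -> \sum_j a 0 j * x 0 j <= b) /\
    F = P `&` [set x | \sum_j a 0 j * x 0 j = b].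

Definition is_facet F P : Prop :=
  is_face F P /\ exists d, has_dim P d.+1 /\ has_dim F d.

(* The closed Euclidean unit ball; the library norm on 'rV[R]_n is the sup
   norm. *)
Definition unit_ball : set 'rV[R]_n := [set x | \sum_j x 0 j ^+ 2 <= 1].

(* fset_set sends an infinite set to fset0; here Q is meant to be bounded. *)
Definition ehrhart Q (k : nat) : nat :=
  #|` fset_set ([set k%:R *: x | x in Q] `&`
                range (map_mx intr : 'rV[int]_n -> 'rV[R]_n)) |.

(* The formula is imposed for k >= 1 only; periodicity of each c i on int makes
   the coefficient functions unique. *)
Definition ehrhart_coefficients Q (c : 'I_n.+1 -> int -> rat) : Prop :=
  (forall i, exists2 p : nat, (0 < p)%N & periodic (c i) p%:Z) /\
  (forall k : nat, (0 < k)%N ->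
     (ehrhart Q k)%:R = \sum_(i < n.+1) c i k%:Z * k%:R ^+ i).

End Polytopes.

Definition homeomorphic {T U : topologicalType} (A : set T) (B : set U) : Prop :=
  exists (f : T -> U) (g : U -> T),
    [/\ set_fun A B f, set_fun B A g,
        {in A, cancel f g} /\ {in B, cancel g f},
        {within A, continuous f} & {within B, continuous g}].

(* The common affine span of the pieces P j is also that of Q, so d is the
   dimension of Q; it agrees with the dimension of the model ball. *)
Definition rational_polytopal_ball {R : realType} {n : nat} (d : nat)
    (Q : set 'rV[R]_n) : Prop :=
  homeomorphic Q (@unit_ball R d) /\
  exists (m : nat) (P : 'I_m -> set 'rV[R]_n),
    [/\ Q = \bigcup_(j in [set: 'I_m]) P j,
        forall j, rational_polytope (P j) /\ has_dim (P j) d,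
        forall j j', affine_span (P j) = affine_span (P j')
      & forall j j', j != j' -> P j `&` P j' !=set0 ->
          is_facet (P j `&` P j') (P j) /\ is_facet (P j `&` P j') (P j')].

Definition min_period (c : int -> rat) (p : nat) : Prop :=
  [/\ (0 < p)%N, periodic c p%:Z
    & forall q : nat, (0 < q)%N -> periodic c q%:Z -> (p <= q)%N].

(* Main.v *)
Require Import Defs.
From mathcomp Require Import all_boot all_order all_algebra.
From mathcomp Require Import finmap.
From mathcomp Require Import all_classical all_reals all_analysis.
From mathcomp Require Import ring lra.

(** For [n = 1] take the segment [[0, 1/p]]. For [n >= 2] the ball is
    [{x | 0 <= x_0 <= T, 0 <= x_j <= f_j(x_0)}] with [f_j] positive, continuous
    and piecewise linear: a chain of convex pieces, each meeting the next one in
    the common facet [x_0 = tau_i]. Rescaling the fibres maps it to a cube, hence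
    to a ball, and its [k]-th dilate has
    [\sum_t \prod_j (floor (k * f_j (t / k)) + 1)] lattice points.

    The heights [f_j] are integral at the breakpoints, except that [f_1] also
    takes the value [1 + 1/p]. Write [M(k) = \prod_(j > 1) (d_j k + 1)] for
    constant integral heights [d_j], [F(k) = \sum_(v < k) floor (v/p)], and
    compute modulo polynomials in [k]. With slope [1/(ap)], going from [1] up to
    [1 + 1/p] contributes [a F M], going back down [(a F + floor (k/p)) M];
    going from [1 + 1/p] up to [3] contributes [- a F M] and from [3] down to
    [1 + 1/p] it is [- (a F + floor (k/p)) M]. Bumps and dents with suitable [a]
    thus combine to [+ floor (k/p) M] and [- floor (k/p) M], and going from [1]
    to [3] with a plateau at [1 + 1/p] gives [k floor (k/p) M]. As the [M] span
    the polynomials of degree at most [n - 2], chains realize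
    [floor (k/p) k^i] for every [i <= n - 1]. Concatenating these for
    [p = p_i] makes the coefficient of [k^i] a constant minus the fractional
    part of [k / p_i]. *)

Set Implicit Arguments.
Unset Strict Implicit.
Unset Printing Implicit Defensive.

Import Order.TTheory GRing.Theory Num.Theory.
Import numFieldNormedType.Exports.

Local Open Scope classical_set_scope.
Local Open Scope ring_scope.

(** * Polynomial functions of bounded degree *)

(** Lattice counts are compared modulo these functions: a polynomial summand does not affect the
    periods of the Ehrhart coefficients. *)
Definition polyfun (d : nat) (F : nat -> rat) :=
  exists q : {poly rat}, (size q <= d.+1)%N /\ forall k, F k = q.[k%:R].

Lemma polyfun_ext d F G : F =1 G -> polyfun d F -> polyfun d G.
Proof. by move=> FG [q [sq Fq]]; exists q; split=> // k; rewrite -FG. Qed.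

Lemma polyfunW d e F : (d <= e)%N -> polyfun d F -> polyfun e F.
Proof. by move=> de [q [sq Fq]]; exists q; split=> //; apply: leq_trans sq _. Qed.

Lemma polyfun_cst d c : polyfun d (fun=> c).
Proof.
exists c%:P; split=> [|k]; last by rewrite hornerC.
by rewrite size_polyC; case: eqP.
Qed.

Lemma polyfun_id : polyfun 1 (fun k => k%:R).
Proof. by exists 'X; split=> [|k]; rewrite ?size_polyX ?hornerX. Qed.

Lemma polyfunD d F G : polyfun d F -> polyfun d G ->
  polyfun d (fun k => F k + G k).
Proof.
move=> [q [sq Fq]] [r [sr Gr]]; exists (q + r); split=> [|k].
  by rewrite (leq_trans (size_polyD _ _))// geq_max sq sr.
by rewrite hornerD Fq Gr.
Qed.

Lemma polyfunM d e F G : polyfun d F -> polyfun e G ->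
  polyfun (d + e) (fun k => F k * G k).
Proof.
move=> [q [sq Fq]] [r [sr Gr]]; exists (q * r); split=> [|k].
  rewrite (leq_trans (size_polyMleq _ _))//.
  by rewrite -subn1 leq_subLR add1n -addSn -addnS leq_add.
by rewrite hornerM Fq Gr.
Qed.

Lemma polyfunZ c d F : polyfun d F -> polyfun d (fun k => c * F k).
Proof. by move=> Fd; apply: (@polyfunM 0) => //; apply: polyfun_cst. Qed.

Lemma polyfunN d F : polyfun d F -> polyfun d (fun k => - F k).
Proof. by move/(polyfunZ (-1)); apply: polyfun_ext => k; rewrite mulN1r. Qed.

Lemma polyfunB d F G : polyfun d F -> polyfun d G ->
  polyfun d (fun k => F k - G k).
Proof. by move=> Fd Gd; apply: polyfunD => //; apply: polyfunN. Qed.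

Lemma polyfun_sum (I : Type) (s : seq I) (P : pred I) d (F : I -> nat -> rat) :
  (forall i, P i -> polyfun d (F i)) ->
  polyfun d (fun k => \sum_(i <- s | P i) F i k).
Proof.
move=> Fd; elim: s => [|x s IHs].
  by apply: polyfun_ext (polyfun_cst d 0) => k; rewrite big_nil.
case Px: (P x); last by apply: polyfun_ext IHs => k; rewrite big_cons Px.
by apply: polyfun_ext (polyfunD (Fd _ Px) IHs) => k; rewrite big_cons Px.
Qed.

Lemma polyfunX d : polyfun d (fun k => k%:R ^+ d).
Proof. by exists 'X^d; split=> [|k]; rewrite ?size_polyXn ?hornerXn. Qed.

Lemma polyfun_prod m (F : 'I_m -> nat -> rat) : (forall j, polyfun 1 (F j)) ->
  polyfun m (fun k => \prod_j F j k).
Proof.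
elim: m F => [|m IHm] F Fd.
  by apply: polyfun_ext (polyfun_cst 0 1) => k; rewrite big_ord0.
have := polyfunM (Fd ord0) (IHm (fun j => F (lift ord0 j)) (fun=> Fd _)).
by apply: polyfun_ext => k; rewrite big_ord_recl.
Qed.

(** Pascal's recursion: the differences [(u+1)^(a+1) - u^(a+1)] telescope to [k^(a+1)], while the
    binomial theorem expands them into powers of exponent at most [a]; the power sum of exponent [a]
    is then solved for. *)
Lemma polyfun_sum_exp a : polyfun a.+1 (fun k => \sum_(u < k) u%:R ^+ a).
Proof.
elim/ltn_ind: a => a IHa.
have Pa : polyfun a.+1 (fun k => a.+1%:R^-1 *
    (k%:R ^+ a.+1 - \sum_(j < a) 'C(a.+1, j)%:R * \sum_(u < k) u%:R ^+ j)).
  apply/polyfunZ/polyfunB; first exact: polyfunX.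
  apply: polyfun_sum => j _; apply: polyfunZ.
  by apply: polyfunW (IHa j (ltn_ord j)); rewrite ltnS ltnW.
apply: polyfun_ext Pa => k.
have <- : \sum_(u < k) (u.+1%:R ^+ a.+1 - u%:R ^+ a.+1) = k%:R ^+ a.+1 :> rat.
  elim: k => [|k IHk]; first by rewrite big_ord0 expr0n.
  by rewrite big_ord_recr /= IHk addrC subrK.
have E (u : 'I_k) : u.+1%:R ^+ a.+1 - u%:R ^+ a.+1 =
    \sum_(j < a.+1) 'C(a.+1, j)%:R * u%:R ^+ j :> rat.
  rewrite -natr1 (addrC u%:R) exprDn big_ord_recr /= subnn expr0 mul1r binn.
  rewrite mulr1n addrK; apply: eq_bigr => j _.
  by rewrite expr1n mul1r mulr_natl.
under eq_bigr do rewrite E.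
rewrite exchange_big /= big_ord_recr /=.
under eq_bigr do rewrite -mulr_sumr.
by rewrite addrAC subrr add0r -mulr_sumr binSn mulKf// pnatr_eq0.
Qed.

(** A triple [(c, a, b)] stands for the monomial [c u^a k^b]. The total degree is bounded, so that
    summation over [u < k] raises it by one only. *)
Definition polyfun2 (d : nat) (F : nat -> nat -> rat) :=
  exists s : seq (rat * nat * nat),
    all (fun x => x.1.2 + x.2 <= d)%N s /\
    forall u k, F u k = \sum_(x <- s) x.1.1 * u%:R ^+ x.1.2 * k%:R ^+ x.2.

Lemma polyfun2_lin (a b c : rat) :
  polyfun2 1 (fun u k => a * u%:R + b * k%:R + c).
Proof.
exists [:: (a, 1, 0); (b, 0, 1); (c, 0, 0)]%N; split=> // u k.
by rewrite !big_cons big_nil /= !expr0 !expr1 !mulr1 addr0 addrA.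
Qed.

Lemma polyfun2M d e F G : polyfun2 d F -> polyfun2 e G ->
  polyfun2 (d + e) (fun u k => F u k * G u k).
Proof.
move=> [s [sd Fs]] [r [rd Gr]].
exists [seq (x.1.1 * y.1.1, (x.1.2 + y.1.2)%N, (x.2 + y.2)%N) | x <- s, y <- r].
split.
  apply/allP => _ /allpairsP[[x y] /= [/(allP sd) xd /(allP rd) yd ->]] /=.
  by rewrite addnACA leq_add.
move=> u k; rewrite Fs Gr big_allpairs_dep mulr_suml; apply: eq_bigr => x _.
by rewrite mulr_sumr; apply: eq_bigr => y _; rewrite /= !exprD; ring.
Qed.

Lemma polyfun2_prod m (F : 'I_m -> nat -> nat -> rat) :
  (forall j, polyfun2 1 (F j)) -> polyfun2 m (fun u k => \prod_j F j u k).
Proof.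
elim: m F => [|m IHm] F Fd.
  exists [:: (1, 0%N, 0%N)]; split=> // u k.
  by rewrite big_ord0 big_seq1 /= !expr0 !mulr1.
have := polyfun2M (Fd ord0) (IHm (fun j => F (lift ord0 j)) (fun=> Fd _)).
case=> s [sd Fs]; exists s; split=> // u k.
by rewrite -Fs big_ord_recl.
Qed.

Lemma polyfun2_sum d F : polyfun2 d F ->
  polyfun d.+1 (fun k => \sum_(u < k) F u k).
Proof.
case=> s [sd Fs].
(* The filter repeats what [sd] grants, so that [polyfun_sum] hands over the degree bound of each
   monomial. *)
suff : polyfun d.+1 (fun k => \sum_(x <- s | (x.1.2 + x.2 <= d)%N)
    x.1.1 * (k%:R ^+ x.2 * \sum_(u < k) u%:R ^+ x.1.2)).
  apply: polyfun_ext => k; under [RHS]eq_bigr do rewrite Fs.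
  rewrite exchange_big /= big_mkcond big_seq [RHS]big_seq.
  apply: eq_bigr => x /(allP sd) ->; rewrite !mulr_sumr.
  by apply: eq_bigr => u _; ring.
apply: polyfun_sum => -[[c a] b] /= ab; apply: polyfunZ.
apply: polyfunW (polyfunM (polyfunX b) (polyfun_sum_exp a)).
by rewrite addnS ltnS addnC.
Qed.

(** Turns the floors of rational heights into Euclidean division on [nat]. *)
Lemma truncn_natDdiv (R : archiRealFieldType) (a m d : nat) : (0 < d)%N ->
  Num.truncn (a%:R + m%:R / d%:R : R) = (a + m %/ d)%N.
Proof.
move=> d_gt0; have d0 : (0 : R) < d%:R by rewrite ltr0n.
apply: truncn_def; rewrite natrD lerD2l ler_pdivlMr// -natrM ler_nat.
rewrite leq_divM /= -addnS natrD ltrD2l ltr_pdivrMr// -natrM ltr_nat.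
exact: ltn_ceil.
Qed.

Lemma sum_divn_block (g : nat -> nat) (a k : nat) : (0 < a)%N ->
  (\sum_(u < k * a) g (u %/ a) = a * \sum_(v < k) g v)%N.
Proof.
move=> a_gt0; elim: k => [|k IHk]; first by rewrite mul0n !big_ord0 muln0.
rewrite mulSn addnC big_split_ord /= IHk big_ord_recr /= mulnDr; congr addn.
transitivity (\sum_(i < a) g k)%N; last by rewrite sum_nat_const card_ord.
apply: eq_bigr => i _.
by rewrite divnMDl// divn_small ?ltn_ord// addn0.
Qed.

(** * Lattice point counts of chains, modulo polynomials *)

Section Chains.
Variables (R : archiRealFieldType) (N : nat).
Implicit Types (h : {ffun 'I_N -> R}) (s : seq (nat * {ffun 'I_N -> R})).

(* Lattice points in the [k]-th dilate of a step of length [l] whose fibre goes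
   linearly from the box of sides [h] to the box of sides [h'], leaving out the
   last slice, which belongs to the next step. *)
Definition block (l : nat) h h' (k : nat) : nat :=
  \sum_(u < k * l) \prod_j
    (Num.truncn (k%:R * h j + u%:R * (h' j - h j) / l%:R)).+1.

Fixpoint chain_count h s (k : nat) : nat :=
  if s is (l, h') :: s' then (block l h h' k + chain_count h' s' k)%N else 0.

Definition good_height h := forall j, 0 < h j /\ exists q : rat, h j = ratr q.

(** The degree bound [N.+1] is the dimension of the body. The chain is nonempty, so that the body
    has positive width. *)
Definition linked h h' (phi : nat -> rat) :=
  exists s, [/\ s != [::],
    forall x, x \in s -> (0 < x.1)%N /\ good_height x.2,
    last h (unzip2 s) = h' &
    polyfun N.+1 (fun k => (chain_count h s k)%:R - phi k)].

Lemma chain_count_cat h s1 s2 k : chain_count h (s1 ++ s2) k =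
  (chain_count h s1 k + chain_count (last h (unzip2 s1)) s2 k)%N.
Proof. by elim: s1 h => //= -[l h'] s1 IHs h; rewrite IHs addnA. Qed.

Lemma linked_ext h h' phi psi : phi =1 psi -> linked h h' phi ->
  linked h h' psi.
Proof.
move=> e [s [? ? ? sp]]; exists s; split=> //.
by apply: polyfun_ext sp => k; rewrite e.
Qed.

Lemma linked_trans h1 h2 h3 phi psi : linked h1 h2 phi -> linked h2 h3 psi ->
  linked h1 h3 (fun k => phi k + psi k).
Proof.
move=> [s [s0 gs ls ps]] [t [t0 gt lt pt]]; exists (s ++ t); split.
- by case: (s) s0.
- by move=> x; rewrite mem_cat => /orP[/gs|/gt].
- by rewrite /unzip2 map_cat last_cat -/(unzip2 s) ls.
- apply: polyfun_ext (polyfunD ps pt) => k.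
  by rewrite chain_count_cat ls natrD addrACA -opprD.
Qed.

Lemma linked_step (l : nat) h h' phi : (0 < l)%N -> good_height h' ->
  polyfun N.+1 (fun k => (block l h h' k)%:R - phi k) -> linked h h' phi.
Proof.
move=> l_gt0 gh' bp; exists [:: (l, h')]; split=> //.
  by move=> x; rewrite inE => /eqP ->.
by apply: polyfun_ext bp => k; rewrite /= addn0.
Qed.

(** With length 1 and integral ends, the dilated height at [u] is the integer [(k - u) e + u e'].
    The floors are exact, and the count is a sum over [u < k] of a polynomial in [u] and [k]. *)
Lemma linked_integral (e e' : 'I_N -> nat) :
  (forall j, 0 < e' j)%N ->
  linked [ffun j => (e j)%:R] [ffun j => (e' j)%:R] (fun=> 0).
Proof.
move=> e'0; apply: (@linked_step 1%N) => //.
  move=> j; rewrite ffunE ltr0n; split=> //.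
  by exists (e' j)%:R; rewrite ratr_nat.
suff : polyfun N.+1 (fun k => \sum_(u < k)
    \prod_j (((e' j)%:R - (e j)%:R) * u%:R + (e j)%:R * k%:R + 1)).
  apply: polyfun_ext => k; rewrite subr0 /block muln1 natr_sum.
  apply: eq_bigr => u _; rewrite natr_prod; apply: eq_bigr => j _.
  have uk : (u <= k)%N by rewrite ltnW.
  have -> : k%:R * [ffun j => (e j)%:R] j +
      u%:R * ([ffun j => (e' j)%:R] j - [ffun j => (e j)%:R] j) / 1%:R =
      ((k - u) * e j + u * e' j)%:R :> R.
    by rewrite !ffunE natrD !natrM natrB// divr1; ring.
  by rewrite natrK -natr1 natrD !natrM natrB//; ring.
apply: (@polyfun2_sum _ (fun u k =>
  \prod_j (((e' j)%:R - (e j)%:R) * u%:R + (e j)%:R * k%:R + 1))).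
by apply: polyfun2_prod => j; apply: polyfun2_lin.
Qed.
End Chains.

(** * Steps that vary one side of the box *)

Section Moves.
Variables (R : archiRealFieldType) (r : nat).
Implicit Types (d : 'I_r -> nat) (y : R) (p a k : nat).

(* The perturbed height [y] comes first, the integral heights [d] follow. *)
Definition node y d : {ffun 'I_r.+1 -> R} :=
  [ffun j => oapp (fun i => (d i)%:R) y (unlift ord0 j)].

Lemma node_nat e d :
  node e%:R d = [ffun j => (oapp d e (unlift ord0 j))%:R].
Proof. by apply/ffunP => j; rewrite !ffunE; case: unliftP. Qed.

(* The factor [M] of the file header. *)
Definition base d k : rat := \prod_j ((d j)%:R * k%:R + 1).

Lemma polyfun_base d : polyfun r (base d).
Proof.
apply: polyfun_prod => j; apply: polyfunD; last exact: polyfun_cst.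
by apply/polyfunZ/polyfun_id.
Qed.

Lemma block_node l y y' d k :
  (block l (node y d) (node y' d) k)%:R = base d k *
  (\sum_(u < k * l) (Num.truncn (k%:R * y + u%:R * (y' - y) / l%:R)).+1)%:R.
Proof.
rewrite /block !natr_sum mulr_sumr; apply: eq_bigr => u _.
rewrite big_ord_recl natrM !ffunE unlift_none /= mulrC; congr (_ * _).
rewrite natr_prod; apply: eq_bigr => j _.
rewrite !ffunE liftK /= subrr mulr0 mul0r addr0 -natrM natrK -natr1 natrM.
by rewrite [_ * k%:R]mulrC.
Qed.

(** Reduces a step to the floors of the varying side: the constant sides contribute the factor
    [base d k], of degree [r], and the [+1] in each slice adds up to the polynomial [k * l]. *)
Lemma linked_node l y y' d phi : (0 < l)%N -> (forall j, 0 < d j)%N ->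
  0 < y' -> (exists q : rat, y' = ratr q) ->
  polyfun 2 (fun k =>
    (\sum_(u < k * l) Num.truncn (k%:R * y + u%:R * (y' - y) / l%:R))%:R
    - phi k) ->
  linked (node y d) (node y' d) (fun k => base d k * phi k).
Proof.
move=> l0 d0 y'0 ry' wp; apply: (linked_step l0).
  move=> j; rewrite ffunE; case: (unliftP ord0 j) => [i|] _ //=.
  by rewrite ltr0n; split=> //; exists (d i)%:R; rewrite ratr_nat.
have lp : polyfun 2 (fun k => k%:R * l%:R).
  apply: (@polyfunM 1 1); [exact: polyfun_id|exact: polyfun_cst].
have := polyfunM (polyfun_base d) (polyfunD wp lp); rewrite addn2.
apply: polyfun_ext => k; rewrite block_node.
under [X in _ = _ * X%:R - _]eq_bigr do rewrite -addn1.
by rewrite big_split /= sum_nat_const card_ord muln1 natrD natrM; ring.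
Qed.

(** The function [F] of the file header, which has to cancel in every loop. *)
Definition flsum p k : nat := \sum_(v < k) v %/ p.

(** The only height in the chains that may fail to be integral. *)
Definition mid p : R := 1 + 1 / p%:R.

Lemma mid_gt0 p : (0 < p)%N -> 0 < mid p.
Proof. by move=> p0; rewrite addr_gt0// divr_gt0// ltr0n. Qed.

Lemma mid_rat p : exists q : rat, mid p = ratr q.
Proof. by exists (1 + 1 / p%:R); rewrite rmorphD fmorph_div rmorph1 rmorph_nat. Qed.

Lemma one_rat : exists q : rat, 1 = ratr q :> R.
Proof. by exists 1; rewrite rmorph1. Qed.

Lemma flsum_block a p k : (0 < a)%N ->
  (\sum_(u < k * a) u %/ (a * p) = a * flsum p k)%N.
Proof.
move=> a0; rewrite -(@sum_divn_block (fun v => v %/ p)%N)//.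
by apply: eq_bigr => u _; rewrite divnMA.
Qed.

Lemma polyfun_bin2 m : polyfun 2 (fun k => (\sum_(u < k * m) u)%:R).
Proof.
have mk : polyfun 1 (fun k => (k * m)%:R).
  by apply: polyfun_ext (polyfunZ m%:R polyfun_id) => k; rewrite natrM mulrC.
have mk1 := polyfunB mk (polyfun_cst 1 1).
have := polyfunZ (2%:R^-1) (polyfunM mk mk1).
apply: polyfun_ext => k; elim: (k * m)%N => [|n IHn].
  by rewrite big_ord0 mul0r mulr0.
rewrite big_ord_recr /= natrD -IHn -natr1.
by field.
Qed.

Section FourMoves.
Variables (p a : nat) (d : 'I_r -> nat).
Hypotheses (p0 : (0 < p)%N) (a0 : (0 < a)%N) (d0 : forall j, (0 < d j)%N).

Let ap0 : (0 < a * p)%N. Proof. by rewrite muln_gt0 a0. Qed.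
Let pR : p%:R != 0 :> R. Proof. by rewrite pnatr_eq0 -lt0n. Qed.
Let aR : a%:R != 0 :> R. Proof. by rewrite pnatr_eq0 -lt0n. Qed.

(* In the four moves below the slope is [1 / (a * p)] up to sign, so that the
   floors of the heights run through [v %/ (a * p)] for consecutive [v]. *)
Lemma linked_rise : linked (node 1 d) (node (mid p) d)
  (fun k => base d k * (a * flsum p k)%:R).
Proof.
apply: (linked_node a0) => //; [exact: mid_gt0|exact: mid_rat|].
have := polyfunM polyfun_id (polyfunZ a%:R polyfun_id).
apply: polyfun_ext => k.
have E (u : 'I_(k * a)) : Num.truncn (k%:R * 1 + u%:R * (mid p - 1) / a%:R : R)
    = (k + u %/ (a * p))%N.
  rewrite -(truncn_natDdiv R)//; congr Num.truncn; rewrite /mid natrM.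
  by field; rewrite pR aR.
under [X in X%:R - _]eq_bigr do rewrite E.
rewrite big_split /= sum_nat_const card_ord flsum_block//.
by rewrite natrD !natrM; ring.
Qed.

(** The half-open step now keeps its top and drops its bottom, so the floors run through
    [v %/ (a * p)] for [v] from [k * a] down to 1. This shift by one is the source of the term
    [k %/ p]. *)
Lemma linked_fall : linked (node (mid p) d) (node 1 d)
  (fun k => base d k * (a * flsum p k + k %/ p)%:R).
Proof.
apply: (linked_node a0) => //; [exact: one_rat|].
have := polyfunM polyfun_id (polyfunZ a%:R polyfun_id).
apply: polyfun_ext => k.
have E (u : 'I_(k * a)) : Num.truncn (k%:R * mid p + u%:R * (1 - mid p) / a%:R : R)
    = (k + (k * a - u) %/ (a * p))%N.
  rewrite -(truncn_natDdiv R)//; congr Num.truncn; rewrite natrB 1?ltnW// !natrM /mid.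
  by field; rewrite pR aR.
under [X in X%:R - _]eq_bigr do rewrite E.
rewrite big_split /= sum_nat_const card_ord.
have -> : (\sum_(u < k * a) (k * a - u) %/ (a * p) = a * flsum p k + k %/ p)%N.
  rewrite -flsum_block// (reindex_inj rev_ord_inj) /=.
  transitivity (\sum_(u < k * a) u.+1 %/ (a * p))%N.
    by apply: eq_bigr => u _; rewrite subKn.
  have -> : (k %/ p = (k * a) %/ (a * p))%N by rewrite mulnC divnMl.
  by rewrite -(big_ord_recr _ (fun u => u %/ (a * p))%N) big_ord_recl div0n.
by rewrite !natrD !natrM; ring.
Qed.

(** The rise from [mid p] to 3 is [(2p - 1) / p]; this length gives it the slope [1 / (a * p)]. *)
Let l := (a * (2 * p - 1))%N.
Let l0 : (0 < l)%N.
Proof. by rewrite muln_gt0 a0 subn_gt0 (leq_trans _ (leq_pmulr 2 p0)). Qed.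
Let lE : l%:R = a%:R * (2 * p%:R - 1) :> R.
Proof. by rewrite natrM natrB ?natrM// (leq_trans _ (leq_pmulr 2 p0)). Qed.
Let lR : 2 * p%:R - 1 != 0 :> R.
Proof.
by apply: contraTneq l0 => e; rewrite -(ltr0n R) lE e mulr0 ltxx.
Qed.

Let klE k : (k * l + k * a = k * 2 * (a * p))%N.
Proof.
rewrite -mulnDr -mulnA; congr (k * _)%N.
have le : (1 <= 2 * p)%N by rewrite muln_gt0 p0.
by rewrite /l mulnCA -[X in (_ + X)%N]muln1 -mulnDr subnK// mulnCA.
Qed.

(** Over the full rise from 1 to 3 each floor occurs exactly [a * p] times, so the sum is
    polynomial. Hence the part above [mid p] is, modulo polynomials, the negative of the part below
    it. *)
Let top_poly : polyfun 2 (fun k => (\sum_(v < k * 2 * (a * p)) v %/ (a * p))%:R).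
Proof.
apply: polyfun_ext (polyfunZ (a * p)%:R (polyfun_bin2 2)) => k.
by rewrite (@sum_divn_block id)// [RHS]natrM.
Qed.

Let sumD k : (\sum_(u < k * l) (k * a + u) %/ (a * p) + a * flsum p k =
  \sum_(v < k * 2 * (a * p)) v %/ (a * p))%N.
Proof.
rewrite -klE -flsum_block// [(k * l + _)%N]addnC big_split_ord /= addnC.
by [].
Qed.

Lemma linked_climb : linked (node (mid p) d) (node 3 d)
  (fun k => base d k * - (a * flsum p k)%:R).
Proof.
apply: (linked_node l0) => //; [by exists 3; rewrite ratr_nat|].
have := polyfunD top_poly (polyfunM polyfun_id (polyfunZ l%:R polyfun_id)).
apply: polyfun_ext => k.
have E (u : 'I_(k * l)) : Num.truncn (k%:R * mid p + u%:R * (3 - mid p) / l%:R : R)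
    = (k + (k * a + u) %/ (a * p))%N.
  rewrite -(truncn_natDdiv R)//; congr Num.truncn; rewrite lE natrD !natrM /mid.
  by field; rewrite pR aR lR.
under [X in _ = X%:R - _]eq_bigr do rewrite E.
rewrite big_split /= sum_nat_const card_ord -sumD.
by rewrite !natrD !natrM; ring.
Qed.

Lemma linked_dive : linked (node 3 d) (node (mid p) d)
  (fun k => base d k * - (a * flsum p k + k %/ p)%:R).
Proof.
apply: (linked_node l0) => //; [exact: mid_gt0|exact: mid_rat|].
have := polyfunD (polyfunD top_poly (polyfunM polyfun_id (polyfunZ l%:R polyfun_id)))
  (polyfunZ 2 (polyfunW (leqnSn 1) polyfun_id)).
apply: polyfun_ext => k.
have E (u : 'I_(k * l)) : Num.truncn (k%:R * 3 + u%:R * (mid p - 3) / l%:R : R)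
    = (k + (k * 2 * (a * p) - u) %/ (a * p))%N.
  have uk : (u <= k * 2 * (a * p))%N.
    by rewrite -klE (leq_trans (ltnW (ltn_ord u)))// leq_addr.
  rewrite -(truncn_natDdiv R)//; congr Num.truncn; rewrite natrB// lE !natrM /mid.
  by field; rewrite pR aR lR.
under [X in _ = X%:R - _]eq_bigr do rewrite E.
rewrite big_split /= sum_nat_const card_ord -sumD.
(* Compared with the climb, the descent drops the value [k %/ p] at the bottom and gains the value
   [k * 2] at the top. *)
have key : (\sum_(u < k * l) (k * 2 * (a * p) - u) %/ (a * p) + k %/ p =
   \sum_(u < k * l) (k * a + u) %/ (a * p) + k * 2)%N.
  rewrite (reindex_inj rev_ord_inj) /=.
  have -> : (\sum_(u < k * l) (k * 2 * (a * p) - (k * l - u.+1)) %/ (a * p) =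
      \sum_(u < k * l) (k * a + u.+1) %/ (a * p))%N.
    apply: eq_bigr => u _; rewrite -klE; congr divn.
    by rewrite subnBA// -addnA addKn.
  have -> : (k %/ p = (k * a + 0) %/ (a * p))%N by rewrite addn0 mulnC divnMl.
  have -> : (k * 2 = (k * a + k * l) %/ (a * p))%N.
    by rewrite addnC klE mulnK.
  rewrite addnC -(big_ord_recr _ (fun u => (k * a + u) %/ (a * p))%N).
  by rewrite big_ord_recl.
move/(congr1 (GRing.natmul (1 : rat))): key.
by rewrite !natrD !natrM; lra.
Qed.
End FourMoves.
End Moves.

(** * Closed chains at the unit box and the counts they realize *)

Section Loops.
Variables (R : archiRealFieldType) (r : nat).
Implicit Types (d : 'I_r -> nat) (p a k : nat).

Lemma linked_flat e e' d d' : (0 < e')%N -> (forall j, 0 < d' j)%N ->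
  linked (node (e%:R : R) d) (node e'%:R d') (fun=> 0).
Proof.
move=> e'0 d'0; rewrite !node_nat; apply: linked_integral => j.
by case: (unlift ord0 j).
Qed.

Lemma linked_plateau p d : (0 < p)%N -> (forall j, 0 < d j)%N ->
  linked (node (mid R p) d) (node (mid R p) d)
    (fun k => base d k * (k%:R * (k %/ p)%:R)).
Proof.
move=> p0 d0; apply: (@linked_node _ _ 1%N) => //; [exact: mid_gt0|exact: mid_rat|].
apply: polyfun_ext (polyfunM polyfun_id polyfun_id) => k.
have E (u : 'I_(k * 1)) :
    Num.truncn (k%:R * mid R p + u%:R * (mid R p - mid R p) / 1%:R)
    = (k + k %/ p)%N.
  rewrite -(truncn_natDdiv R)//; congr Num.truncn; rewrite subrr mulr0 mul0r addr0.
  by rewrite /mid; ring.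
under [X in _ = X%:R - _]eq_bigr do rewrite E.
rewrite sum_nat_const card_ord muln1 natrM natrD.
by ring.
Qed.

Definition ones : {ffun 'I_r.+1 -> R} := node 1 (fun=> 1%N).

(** A common base point lets chains be concatenated in any order, which adds their counts. *)
Definition loop (phi : nat -> rat) := linked ones ones phi.

Lemma loopD phi psi : loop phi -> loop psi -> loop (fun k => phi k + psi k).
Proof. exact: linked_trans. Qed.

Lemma loop0 : loop (fun=> 0).
Proof. exact: (@linked_flat 1 1). Qed.

Lemma loop_sum (I : Type) (s : seq I) (phi : I -> nat -> rat) :
  (forall i, loop (phi i)) -> loop (fun k => \sum_(i <- s) phi i k).
Proof.
move=> lphi; elim: s => [|i s IHs].
  by apply: linked_ext loop0 => k; rewrite big_nil.
by apply: linked_ext (loopD (lphi i) IHs) => k; rewrite big_cons.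
Qed.

(** Integral steps lead from [ones] to the sides [d] and back, at the cost of a polynomial only. *)
Lemma loop_at d phi : (forall j, 0 < d j)%N ->
  linked (node (1 : R) d) (node 1 d) phi -> loop phi.
Proof.
move=> d0 lphi.
have l1 := @linked_flat 1 1 (fun=> 1%N) d isT d0.
have l2 := @linked_flat 1 1 d (fun=> 1%N) isT (fun=> isT).
apply: linked_ext (linked_trans l1 (linked_trans lphi l2)) => k.
by rewrite addr0 add0r.
Qed.

Section Period.
Variable p : nat.
Hypothesis p0 : (0 < p)%N.

Let bump a d : (0 < a)%N -> (forall j, 0 < d j)%N ->
  linked (node (1 : R) d) (node 1 d)
    (fun k => base d k * ((2 * a * flsum p k)%:R + (k %/ p)%:R)).
Proof.
move=> a0 d0.
apply: linked_ext (linked_trans (linked_rise R p0 a0 d0) (linked_fall R p0 a0 d0)) => k.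
by rewrite !natrD !natrM; ring.
Qed.

(** The dive from 3 and the climb back are enclosed by integral steps between 1 and 3, which count
    as 0. *)
Let dent a d : (0 < a)%N -> (forall j, 0 < d j)%N ->
  linked (node (1 : R) d) (node 1 d)
    (fun k => base d k * - ((2 * a * flsum p k)%:R + (k %/ p)%:R)).
Proof.
move=> a0 d0.
have l1 := @linked_flat 1 3 d d isT d0.
have l2 := @linked_flat 3 1 d d isT d0.
have := linked_trans (linked_trans l1 (linked_dive R p0 a0 d0))
  (linked_trans (linked_climb R p0 a0 d0) l2).
by apply: linked_ext => k; rewrite !natrD !natrM; ring.
Qed.

(** Two bumps with [a = 1] and a dent with [a = 2]: the multiples of [flsum] cancel, and one of the
    two floors is left. *)
Lemma loop_floor d : (forall j, 0 < d j)%N ->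
  loop (fun k => base d k * (k %/ p)%:R).
Proof.
move=> d0; apply: (loop_at d0).
have b := @bump 1%N d isT d0.
apply: linked_ext (linked_trans (linked_trans b b) (@dent 2%N d isT d0)) => k.
by rewrite !natrM; ring.
Qed.

Lemma loop_opp_floor d : (forall j, 0 < d j)%N ->
  loop (fun k => - base d k * (k %/ p)%:R).
Proof.
move=> d0; apply: (loop_at d0).
have b := @dent 1%N d isT d0.
apply: linked_ext (linked_trans (linked_trans b b) (@bump 2%N d isT d0)) => k.
by rewrite !natrM; ring.
Qed.

(** The rise and the climb, both with [a = 1], cancel each other; only the plateau at [mid p]
    remains. *)
Lemma loop_mul_floor d : (forall j, 0 < d j)%N ->
  loop (fun k => base d k * (k%:R * (k %/ p)%:R)).
Proof.
move=> d0; apply: (loop_at d0).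
have := linked_trans (linked_rise R p0 (ltn0Sn 0) d0)
  (linked_trans (linked_plateau p0 d0)
  (linked_trans (linked_climb R p0 (ltn0Sn 0) d0) (@linked_flat 3 1 d d isT d0))).
by apply: linked_ext => k; ring.
Qed.

(** Concatenation only adds counts; carrying both signs makes subtraction available as well. *)
Definition signed_loop (g : nat -> rat) :=
  loop (fun k => g k * (k %/ p)%:R) /\ loop (fun k => - g k * (k %/ p)%:R).

Lemma signed_loop_ext f g : f =1 g -> signed_loop f -> signed_loop g.
Proof.
by move=> e [f1 f2]; split; [apply: linked_ext f1|apply: linked_ext f2] => k; rewrite e.
Qed.

Lemma signed_loopD f g : signed_loop f -> signed_loop g ->
  signed_loop (fun k => f k + g k).
Proof.
move=> [f1 f2] [g1 g2]; split.
  by apply: linked_ext (loopD f1 g1) => k; rewrite mulrDl.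
by apply: linked_ext (loopD f2 g2) => k; rewrite opprD mulrDl.
Qed.

Lemma signed_loopN f : signed_loop f -> signed_loop (fun k => - f k).
Proof.
by move=> [f1 f2]; split=> //; apply: linked_ext f1 => k; rewrite opprK.
Qed.

(* Lowers [size s] to 0 by trading a factor: [(2k+1) - (k+1) = k] and
   [2(k+1) - (2k+1) = 1]. *)
Lemma signed_loop_mixed m l (s : seq nat) : (size s + m = r)%N -> (l <= m)%N ->
  all (leq 1) s ->
  signed_loop (fun k => k%:R ^+ l * \prod_(e <- s) (e%:R * k%:R + 1)).
Proof.
elim: m l s => [|m IHm] l s sm lm s0.
  move: lm; rewrite leqn0 => /eqP ->; rewrite addn0 in sm.
  have d0 (j : 'I_r) : (0 < nth 1 s j)%N.
    by apply: (allP s0); rewrite mem_nth// sm.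
  have := conj (loop_floor d0) (loop_opp_floor d0).
  apply: signed_loop_ext => k; rewrite expr0 mul1r (big_nth 1%N) big_mkord sm.
  by [].
have sm' e : (size (e :: s) + m = r)%N by rewrite /= addSnnS.
case: l lm => [|l] lm.
  have l1 := IHm 0%N (1%N :: s) (sm' _) isT s0.
  have l2 := IHm 0%N (2%N :: s) (sm' _) isT s0.
  apply: signed_loop_ext (signed_loopD (signed_loopD l1 l1) (signed_loopN l2)) => k.
  by rewrite !big_cons; ring.
have l1 := IHm l (1%N :: s) (sm' _) lm s0.
have l2 := IHm l (2%N :: s) (sm' _) lm s0.
apply: signed_loop_ext (signed_loopD l2 (signed_loopN l1)) => k.
by rewrite !big_cons exprS; ring.
Qed.

Lemma signed_loop_exp l : (l <= r)%N -> signed_loop (fun k => k%:R ^+ l).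
Proof.
move=> lr; have := @signed_loop_mixed r l [::] erefl lr isT.
by apply: signed_loop_ext => k; rewrite big_nil mulr1.
Qed.

(** The exponent [r.+1] exceeds the degree [r] of [base]. It comes from the plateau, which with unit
    sides yields [k (k+1)^r]; the lower powers are removed by [signed_loop_exp]. *)
Lemma loop_exp_floor l : (l <= r.+1)%N ->
  loop (fun k => k%:R ^+ l * (k %/ p)%:R).
Proof.
rewrite leq_eqVlt => /orP[/eqP ->|]; last by case/signed_loop_exp.
have low : loop (fun k => \sum_(i < r) (- k%:R ^+ i.+1 * (k %/ p)%:R) *+ 'C(r, i)).
  have h (i : 'I_r) : loop (fun k => (- k%:R ^+ i.+1 * (k %/ p)%:R) *+ 'C(r, i)).
    have [_ li] := signed_loop_exp (ltn_ord i).
    (* The binomial coefficient is realized by repeating the loop. *)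
    elim: 'C(r, i) => [|c IHc]; first exact: loop0.
    by apply: linked_ext (loopD li IHc) => k; rewrite mulrS.
  exact: loop_sum.
apply: linked_ext (loopD (@loop_mul_floor (fun=> 1%N) (fun=> isT)) low) => k.
rewrite /base prodr_const card_ord mul1r addrC (addrC k%:R) exprDn.
rewrite big_ord_recr /= binn mulr1n expr1n mul1r mulrDl mulr_suml addrA.
rewrite -big_split /= big1 ?add0r => [|i _]; first by rewrite exprS; ring.
by rewrite expr1n mul1r exprS; ring.
Qed.
End Period.
End Loops.

(** * The body under a graph is a ball *)

Section Homeo.
Variable R : realType.

Lemma cvg_rV (T : Type) (F : set_system T) (FF : Filter F) n
    (f : T -> 'rV[R]_n) (l : 'rV[R]_n) :
  (forall j, (fun x => f x 0 j) @ F --> l 0 j) -> f @ F --> l.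
Proof.
move=> fl; apply/cvg_ballP => e e0.
have : \forall x \near F, forall j, ball (l 0 j) e (f x 0 j).
  by apply: filter_forall => j; apply: (cvg_ball (fl j)).
apply: filterS => x xe; split=> // i j.
by rewrite ord1.
Qed.

Lemma cvg_bigsum (T I : Type) (F : set_system T) (FF : Filter F) (s : seq I)
    (P : pred I) (f : I -> T -> R) (l : I -> R) :
  (forall i, P i -> f i x @[x --> F] --> l i) ->
  \sum_(i <- s | P i) f i x @[x --> F] --> \sum_(i <- s | P i) l i.
Proof. by apply: cvg_big; exact: add_continuous. Qed.

Lemma coord_le_norm n (x : 'rV[R]_n) j : `|x 0 j| <= `|x|.
Proof.
rewrite [leRHS]/Num.norm /= mx_normrE; apply/bigmax_geP; right => /=.
by exists (0, j).
Qed.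

Lemma norm_le_coord n (x : 'rV[R]_n) (e : R) : 0 <= e ->
  (forall j, `|x 0 j| <= e) -> `|x| <= e.
Proof.
move=> e0 xe; rewrite /Num.norm /= mx_normrE; apply/bigmax_leP; split=> //.
by move=> [i j] _ /=; rewrite ord1.
Qed.

(** The Euclidean norm, needed because [unit_ball] is Euclidean while the norm of row vectors is the
    sup norm. *)
Definition l2 n (x : 'rV[R]_n) : R := Num.sqrt (\sum_j x 0 j ^+ 2).

Lemma l2_ge0 n (x : 'rV[R]_n) : 0 <= l2 x. Proof. exact: sqrtr_ge0. Qed.

Lemma coord_le_l2 n (x : 'rV[R]_n) j : `|x 0 j| <= l2 x.
Proof.
rewrite -sqrtr_sqr ler_wsqrtr// (bigD1 j)//= lerDl sumr_ge0// => i _.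
exact: sqr_ge0.
Qed.

Lemma norm_le_l2 n (x : 'rV[R]_n) : `|x| <= l2 x.
Proof. by apply: norm_le_coord (coord_le_l2 x); apply: l2_ge0. Qed.

Lemma l2Z n (a : R) (x : 'rV[R]_n) : l2 (a *: x) = `|a| * l2 x.
Proof.
rewrite /l2 -sqrtr_sqr -sqrtrM ?sqr_ge0// mulr_sumr; congr Num.sqrt.
by apply: eq_bigr => j _; rewrite mxE exprMn.
Qed.

Lemma l2_eq0 n (x : 'rV[R]_n) : (l2 x == 0) = (x == 0).
Proof.
apply/eqP/eqP => [x0|->]; last first.
  by rewrite /l2 big1 ?sqrtr0// => j _; rewrite mxE expr0n.
by apply/eqP; rewrite -normr_le0 -x0 norm_le_l2.
Qed.

Lemma l2_continuous n : continuous (@l2 n).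
Proof.
move=> x.
apply: (@continuous_comp _ _ _ (fun x : 'rV[R]_n => \sum_j x 0 j ^+ 2) Num.sqrt);
  last exact: sqrt_continuous.
apply: (@cvg_bigsum _ _ (nbhs x) (nbhs_filter x)) => j _.
apply: (@continuous_comp _ _ _ (fun x : 'rV[R]_n => x 0 j) (fun y => y ^+ 2)).
  exact: coord_continuous.
exact: exprn_continuous.
Qed.

(* For norms [f] and [g], this maps the unit ball of [f] onto that of [g]. *)
Definition radial n (f g : 'rV[R]_n -> R) (x : 'rV[R]_n) := (f x / g x) *: x.

(** Away from 0 this is a quotient of continuous functions. At 0 the image has norm at most [f x],
    because [|x| <= g x], and [f x] tends to 0. *)
Lemma radial_continuous n (f g : 'rV[R]_n -> R) :
  continuous f -> continuous g -> f 0 = 0 ->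
  (forall x, `|x| <= g x) -> (forall x, 0 <= f x) -> (forall x, g x = 0 -> x = 0) ->
  continuous (radial f g).
Proof.
move=> cf cg f0 xg f_ge0 g0 x; have [->|x0] := eqVneq x 0; last first.
  have FF := nbhs_filter x.
  apply: (@cvgZ _ _ _ (nbhs x) FF (fun y => f y / g y) id); last exact: cvg_id.
  apply: (@cvgM _ _ (nbhs x) FF f (fun y => (g y)^-1)); first exact: cf.
  by apply: cvgV; [apply: contra_neq x0 => /g0|exact: cg].
rewrite /continuous_at /radial [X in _ --> X]scaler0.
apply: (@norm_cvg0 _ _ _ _ (nbhs_filter (0 : 'rV[R]_n))).
have fc : f x @[x --> (0 : 'rV[R]_n)] --> (0 : R).
  by have := cf 0; rewrite /continuous_at f0.

apply: (@squeeze_cvgr _ _ (nbhs_filter (0 : 'rV[R]_n)) _ (fun=> 0) f) => //;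
  last exact: cvg_cst.
near=> y; rewrite normr_ge0 /= normrZ normrM (ger0_norm (f_ge0 y)) -mulrA.
have gy : 0 <= g y by apply: le_trans (xg y).
rewrite ler_piMr ?f_ge0// normfV (ger0_norm gy).
have [gy0|gy0] := eqVneq (g y) 0; first by rewrite gy0 invr0 mul0r.
by rewrite mulrC ler_pdivrMr ?mul1r// lt_neqAle eq_sym gy0.
Unshelve. all: by end_near.
Qed.
End Homeo.

Section Graph.
Variable R : realType.

Lemma radialK n (f g : 'rV[R]_n -> R) :
  (forall a x, f (a *: x) = `|a| * f x) -> (forall a x, g (a *: x) = `|a| * g x) ->
  (forall x, 0 <= f x) -> (forall x, 0 <= g x) ->
  (forall x, (f x == 0) = (x == 0)) -> (forall x, (g x == 0) = (x == 0)) ->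
  cancel (radial f g) (radial g f).
Proof.
move=> fZ gZ f_ge0 g_ge0 f0 g0 x; have [->|x0] := eqVneq x 0.
  by rewrite /radial !scaler0.
have fx : f x != 0 by rewrite f0.
have gx : g x != 0 by rewrite g0.
rewrite /radial fZ gZ scalerA ger0_norm ?divr_ge0//.
by rewrite [X in X *: _](_ : _ = 1) ?scale1r//; field; rewrite fx gx.
Qed.

Definition ball_of_cube n := @radial R n (fun x => `|x|) (@l2 R n).
Definition cube_of_ball n := @radial R n (@l2 R n) (fun x => `|x|).

Lemma ball_of_cubeK n : cancel (@ball_of_cube n) (@cube_of_ball n).
Proof.
apply: radialK => [a x|a x|x|x|x|x];
  [exact: normrZ|exact: l2Z|exact: normr_ge0|exact: l2_ge0|exact: normr_eq0|exact: l2_eq0].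
Qed.

Lemma cube_of_ballK n : cancel (@cube_of_ball n) (@ball_of_cube n).
Proof.
apply: radialK => [a x|a x|x|x|x|x];
  [exact: l2Z|exact: normrZ|exact: l2_ge0|exact: normr_ge0|exact: l2_eq0|exact: normr_eq0].
Qed.

Lemma ball_of_cube_continuous n : continuous (@ball_of_cube n).
Proof.
apply: radial_continuous; [exact: norm_continuous|exact: l2_continuous|exact: normr0
  |exact: norm_le_l2|by move=> x; apply: normr_ge0|].
by move=> x /eqP; rewrite l2_eq0 => /eqP.
Qed.

Lemma cube_of_ball_continuous n : continuous (@cube_of_ball n).
Proof.
apply: radial_continuous; [exact: l2_continuous|exact: norm_continuous|
  |by []|by move=> x; apply: l2_ge0|by move=> x /eqP; rewrite normr_eq0 => /eqP].
by apply/eqP; rewrite l2_eq0.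
Qed.

Lemma unit_ball_of_cube n (x : 'rV[R]_n) :
  unit_ball (ball_of_cube x) <-> `|x| <= 1.
Proof.
have -> : `|x| = l2 (ball_of_cube x).
  rewrite /ball_of_cube /radial l2Z.
  have [->|x0] := eqVneq x 0; first by rewrite normr0 mul0r normr0 mul0r.
  by rewrite ger0_norm ?divr_ge0 ?l2_ge0// divfK// l2_eq0.
rewrite /unit_ball /= /l2 -[X in _ <-> _ <= X]sqrtr1.
by rewrite ler_sqrt// ltr01.
Qed.

Variables (N : nat) (T : R) (g : 'I_N -> R -> R).
Hypotheses (T0 : 0 < T) (g0 : forall j t, 0 < g j t).
Hypothesis gc : forall j, continuous (g j).

Definition body : set 'rV[R]_N.+1 := [set x | 0 <= x 0 0 <= T /\
  forall j, 0 <= x 0 (lift ord0 j) <= g j (x 0 0)].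

(** Maps [[0, T]] and every [[0, g j t]] affinely onto [[-1, 1]], so that the body becomes the unit
    ball of the sup norm. *)
Definition to_cube (x : 'rV[R]_N.+1) : 'rV[R]_N.+1 := \row_i
  oapp (fun j => 2 * x 0 (lift ord0 j) / g j (x 0 0) - 1) (2 * x 0 0 / T - 1)
    (unlift ord0 i).

Definition of_cube (y : 'rV[R]_N.+1) : 'rV[R]_N.+1 :=
  let t := (y 0 0 + 1) * T / 2 in
  \row_i oapp (fun j => (y 0 (lift ord0 j) + 1) * g j t / 2) t (unlift ord0 i).

Let T1 : T != 0. Proof. by rewrite gt_eqF. Qed.
Let g1 j t : g j t != 0. Proof. by rewrite gt_eqF. Qed.

Lemma to_cubeK : cancel to_cube of_cube.
Proof.
move=> x; apply/rowP => i; rewrite !mxE unlift_none /=.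
have -> : (2 * x 0 0 / T - 1 + 1) * T / 2 = x 0 0 by field.
case: unliftP => [j|] -> //=.
by rewrite mxE liftK /=; field.
Qed.

Lemma of_cubeK : cancel of_cube to_cube.
Proof.
move=> x; apply/rowP => i; rewrite !mxE unlift_none /=.
case: unliftP => [j|] -> /=; last by field.
by rewrite mxE liftK /=; field.
Qed.

Lemma to_cube_continuous : continuous to_cube.
Proof.
move=> x; have FF := nbhs_filter x.
apply: cvg_rV => i; rewrite mxE.
under eq_fun do rewrite mxE.
have c0 : y 0 0 @[y --> x] --> x 0 0 by apply: coord_continuous.
case: unliftP => [j|] _ /=.
  apply: (@cvgB _ _ _ (nbhs x) FF); last exact: cvg_cst.
  apply: (@cvgM _ _ (nbhs x) FF).
    apply: (@cvgM _ _ (nbhs x) FF); first exact: cvg_cst.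
    exact: coord_continuous.
  apply: (@cvgV _ _ (nbhs x) FF) => //.
  by apply: (@cvg_comp _ _ _ (fun y : 'rV[R]_N.+1 => y 0 0) (g j) _ _ _ c0); apply: gc.
apply: (@cvgB _ _ _ (nbhs x) FF); last exact: cvg_cst.
apply: (@cvgM _ _ (nbhs x) FF); last exact: cvg_cst.
by apply: (@cvgM _ _ (nbhs x) FF); first exact: cvg_cst.
Qed.

Lemma of_cube_continuous : continuous of_cube.
Proof.
move=> x; have FF := nbhs_filter x.
apply: cvg_rV => i; rewrite mxE.
under eq_fun do rewrite mxE.
have c0 : (y 0 0 + 1) * T / 2 @[y --> x] --> (x 0 0 + 1) * T / 2.
  apply: (@cvgM _ _ (nbhs x) FF); last exact: cvg_cst.
  apply: (@cvgM _ _ (nbhs x) FF); last exact: cvg_cst.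
  apply: (@cvgD _ _ _ (nbhs x) FF); last exact: cvg_cst.
  exact: coord_continuous.
case: unliftP => [j|] _ //=.
apply: (@cvgM _ _ (nbhs x) FF); last exact: cvg_cst.
apply: (@cvgM _ _ (nbhs x) FF).
  apply: (@cvgD _ _ _ (nbhs x) FF); last exact: cvg_cst.
  exact: coord_continuous.
by apply: (@cvg_comp _ _ _ (fun y : 'rV[R]_N.+1 => (y 0 0 + 1) * T / 2) (g j) _ _ _ c0);
  apply: gc.
Qed.

Lemma body_cube x : body x <-> `|to_cube x| <= 1.
Proof.
have E0 : to_cube x 0 0 = 2 * x 0 0 / T - 1 by rewrite mxE unlift_none.
have E1 j : to_cube x 0 (lift ord0 j) = 2 * x 0 (lift ord0 j) / g j (x 0 0) - 1.
  by rewrite mxE liftK.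
have key (a b : R) : 0 < b -> (`|2 * a / b - 1| <= 1) = (0 <= a <= b).
  move=> b0; rewrite ler_norml lerBrDr addNr pmulr_lge0 ?invr_gt0// pmulr_rge0//.
  by rewrite lerBlDr ler_pdivrMr// (_ : 1 + 1 = 2)// ler_pM2l.
split=> [[x0 xj]|le1].
  apply: norm_le_coord => // i; case: (unliftP ord0 i) => [j|] ->.
    by rewrite E1 key.
  by rewrite E0 key.
split=> [|j].
  by rewrite -key// -E0; apply: le_trans (coord_le_norm _ _) le1.
by rewrite -key// -E1; apply: le_trans (coord_le_norm _ _) le1.
Qed.

Lemma body_homeomorphic : homeomorphic body (@unit_ball R N.+1).
Proof.
have fK x : (of_cube \o @cube_of_ball N.+1) ((@ball_of_cube N.+1 \o to_cube) x) = x.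
  by rewrite /= ball_of_cubeK to_cubeK.
have gK x : (@ball_of_cube N.+1 \o to_cube) ((of_cube \o @cube_of_ball N.+1) x) = x.
  by rewrite /= of_cubeK cube_of_ballK.
have fE x : body x <-> unit_ball ((@ball_of_cube N.+1 \o to_cube) x).
  by rewrite /= unit_ball_of_cube body_cube.
exists (@ball_of_cube N.+1 \o to_cube), (of_cube \o @cube_of_ball N.+1); split.
- by move=> x /fE.
- by move=> y By; apply/fE; rewrite gK.
- by split=> x _; [exact: fK|exact: gK].
- apply: continuous_subspaceT => x; apply: continuous_comp.
    exact: to_cube_continuous.
  exact: ball_of_cube_continuous.
- apply: continuous_subspaceT => x; apply: continuous_comp.
    exact: cube_of_ball_continuous.
  exact: of_cube_continuous.
Qed.
End Graph.

(** * Decomposition into polytopes *)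

Section Hulls.
Variables (R : realType) (n : nat).
Implicit Types A : set 'rV[R]_n.

Lemma convex_hull_fin A (I : finType) (v : I -> 'rV[R]_n) (l : I -> R) :
  (forall i, A (v i)) -> (forall i, 0 <= l i) -> \sum_i l i = 1 ->
  convex_hull A (\sum_i l i *: v i).
Proof.
move=> Av l0 l1; exists #|I|, (fun i => v (enum_val i)), (fun i => l (enum_val i)).
split=> //.
  by rewrite -l1 [RHS]big_enum_val.
by rewrite [LHS]big_enum_val.
Qed.

(** The points [c] and [c + e i *: row i B] form a frame: [c + w *m B] has weight [w 0 i / e i] at
    the [i]-th of them, and [c] takes the remaining weight. *)
Lemma affine_span_frame A d (c : 'rV[R]_n) (B : 'M[R]_(d, n)) (e : 'I_d -> R) :
  A c -> (forall i, e i != 0) -> (forall i, A (c + e i *: row i B)) ->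
  (forall x, A x -> exists w, x = c + w *m B) ->
  affine_span A = [set c + w *m B | w in [set: 'rV[R]_d]].
Proof.
move=> Ac e0 Ae AB; apply/seteqP; split=> [x [k [v [l [Av l1 ->]]]]|_ [w _ <-]].
  have /choice[w vw] : forall i, exists w, v i = c + w *m B by move=> i; apply: AB.
  exists (\sum_i l i *: w i) => //.
  rewrite mulmx_suml -[c in LHS]scale1r -l1 scaler_suml -big_split /=.
  by apply: eq_bigr => i _; rewrite vw scalerDr scalemxAl.
pose l i := w 0 i / e i.
exists d.+1, (fun i => oapp (fun j => c + e j *: row j B) c (unlift ord0 i)),
  (fun i => oapp l (1 - \sum_j l j) (unlift ord0 i)); split.
- by move=> i; case: unliftP => [j|] _ /=.
- rewrite big_ord_recl unlift_none /=; under [X in _ + X]eq_bigr do rewrite liftK /=.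
  by rewrite subrK.
- rewrite big_ord_recl unlift_none /=.
  under [X in _ = _ + X]eq_bigr do rewrite liftK /= scalerDr.
  rewrite big_split /= -scaler_suml addrA -scalerDl subrK scale1r mulmx_sum_row.
  by congr (_ + _); apply: eq_bigr => i _; rewrite scalerA divfK.
Qed.

Lemma has_dim_frame A d (c : 'rV[R]_n) (B : 'M[R]_(d, n)) (e : 'I_d -> R) :
  row_free B -> A c -> (forall i, e i != 0) -> (forall i, A (c + e i *: row i B)) ->
  (forall x, A x -> exists w, x = c + w *m B) -> has_dim A d.
Proof.
by move=> fB Ac e0 Ae AB; exists c, B; split; last exact: affine_span_frame Ae AB.
Qed.
End Hulls.

Definition isrational (R : realType) (x : R) := exists q : rat, x = ratr q.

(** * Convex pieces over an interval where the heights are affine *)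

Section Slab.
Variables (R : realType) (N : nat) (g : 'I_N -> R -> R) (a b : R).
Hypothesis (g0 : forall j t, 0 < g j t) (ab : a < b).
Hypothesis gE : forall j t, a <= t <= b ->
  g j t = g j a + (t - a) / (b - a) * (g j b - g j a).

Definition slab : set 'rV[R]_N.+1 := [set x | a <= x 0 0 <= b /\
  forall j, 0 <= x 0 (lift ord0 j) <= g j (x 0 0)].

Definition slab_vertex (s : bool * {ffun 'I_N -> bool}) : 'rV[R]_N.+1 :=
  let t := if s.1 then b else a in
  \row_i oapp (fun j => (s.2 j)%:R * g j t) t (unlift ord0 i).

Let ba0 : b - a != 0. Proof. by rewrite subr_eq0 gt_eqF. Qed.

Lemma slab_vertexP s : slab (slab_vertex s).
Proof.
rewrite /slab /slab_vertex /= !mxE unlift_none /=; split.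
  by case: s.1; rewrite ?lexx ltW.
move=> j; rewrite mxE liftK /= mulr_ge0 ?ler0n ?(ltW (g0 _ _))//=.
by case: (s.2 j); rewrite /= ?mul1r ?mul0r ?lexx ?(ltW (g0 _ _)).
Qed.

(** By [gE] each [g j] is affine on [[a, b]], hence commutes with convex combinations, and the upper
    bounds are preserved. *)
Lemma slab_convex k (v : 'I_k -> 'rV[R]_N.+1) (l : 'I_k -> R) :
  (forall i, slab (v i)) -> (forall i, 0 <= l i) -> \sum_i l i = 1 ->
  slab (\sum_i l i *: v i).
Proof.
move=> sv l0 l1.
have cE j : (\sum_i l i *: v i) 0 j = \sum_i l i * v i 0 j.
  by rewrite summxE; apply: eq_bigr => i _; rewrite mxE.
have x0 : a <= \sum_i l i * v i 0 0 <= b.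
  apply/andP; split; [rewrite -[a]mul1r|rewrite -[b]mul1r]; rewrite -l1 mulr_suml;
    by apply: ler_sum => i _; rewrite ler_wpM2l//; have [/andP[]] := sv i.
split=> [|j]; rewrite !cE//.
rewrite sumr_ge0 /= => [|i _]; last first.
  by rewrite mulr_ge0//; have [_ /(_ j)/andP[]] := sv i.
have -> : g j (\sum_i l i * v i 0 0) = \sum_i l i * g j (v i 0 0).
  rewrite gE//.
  transitivity (\sum_i (l i * (g j a - a / (b - a) * (g j b - g j a)) +
     l i * v i 0 0 / (b - a) * (g j b - g j a))).
    rewrite big_split /= -!mulr_suml l1.
    by field.
  apply: eq_bigr => i _; have [vi _] := sv i; rewrite (gE _ vi).
  by field.
apply: ler_sum => i _; rewrite ler_wpM2l//.
by have [_ /(_ j)/andP[]] := sv i.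
Qed.

Lemma slab_hull : slab = convex_hull (range slab_vertex).
Proof.
apply/seteqP; split=> [x [x0 xj]|x [k [v [l [vV l0 l1 ->]]]]]; last first.
  by apply: slab_convex => // i; have [s _ <-] := vV i; apply: slab_vertexP.
(* Multilinear interpolation of [x] from the vertices. *)
pose s := (x 0 0 - a) / (b - a).
pose th j := x 0 (lift ord0 j) / g j (x 0 0).
pose w0 (e : bool) := if e then s else 1 - s.
pose F j (c : bool) := if c then th j else 1 - th j.
pose w (p : bool * {ffun 'I_N -> bool}) := w0 p.1 * \prod_j F j (p.2 j).
have s01 : 0 <= s <= 1.
  rewrite divr_ge0 ?subr_ge0 ?(ltW ab) ?(andP x0).1//=.
  by rewrite ler_pdivrMr ?subr_gt0// mul1r lerD2r (andP x0).2.
have th01 j : 0 <= th j <= 1.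
  have /andP[xj0 xj1] := xj j.
  by rewrite divr_ge0 ?(ltW (g0 _ _))//= ler_pdivrMr// mul1r.
(* The products of the [F j] are the law of independent bits with means [th j]: [F1] gives the total
   mass, [Fth] the means. *)
have F1 : \sum_(f : {ffun 'I_N -> bool}) \prod_j F j (f j) = 1.
  rewrite -(bigA_distr_bigA F) big1// => j _.
  by rewrite big_bool /= addrC subrK.
have Fth i : \sum_(f : {ffun 'I_N -> bool}) (\prod_j F j (f j)) * (f i)%:R = th i.
  (* The bit [f i] is absorbed into the [i]-th factor, so that sum and product can still be
     exchanged. *)
  pose F' j c := F j c * (if j == i then c%:R else 1).
  transitivity (\sum_(f : {ffun 'I_N -> bool}) \prod_j F' j (f j)).
    apply: eq_bigr => f _; rewrite big_split /=; congr (_ * _).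
    by rewrite -big_mkcond big_pred1_eq.
  rewrite -(bigA_distr_bigA F') (bigD1 i)//= [X in _ * X]big1 ?mulr1.
    by rewrite big_bool /F' eqxx /= mulr1 mulr0 addr0.
  move=> j ji; rewrite big_bool /F' (negbTE ji) /= !mulr1.
  by rewrite addrC subrK.
have w1 : \sum_p w p = 1.
  rewrite -(pair_bigA _ (fun e (f : {ffun 'I_N -> bool}) => w0 e * \prod_j F j (f j))) /=.
  under eq_bigr do rewrite -mulr_sumr F1 mulr1.
  by rewrite big_bool /= addrC subrK.
have w_ge0 p : 0 <= w p.
  have /andP[s0 s1] := s01.
  rewrite mulr_ge0//; first by rewrite /w0; case: p.1; rewrite ?subr_ge0.
  apply: prodr_ge0 => j _; have /andP[t0 t1] := th01 j.
  by rewrite /F; case: (p.2 j); rewrite ?subr_ge0.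
suff -> : x = \sum_p w p *: slab_vertex p.
  by apply: convex_hull_fin => // p; exists p.
apply/rowP => i; rewrite summxE.
under eq_bigr do rewrite mxE.
rewrite -(pair_bigA _ (fun e (f : {ffun 'I_N -> bool}) =>
  w (e, f) * slab_vertex (e, f) 0 i)) /=.
case: (unliftP ord0 i) => [j|] ->.
  transitivity (\sum_e w0 e * g j (if e then b else a) * th j); last first.
    apply: eq_bigr => e _; rewrite -Fth mulr_sumr; apply: eq_bigr => f _.
    by rewrite mxE liftK /= /w /=; ring.
  rewrite big_bool /= -mulrDl.
  have -> : s * g j b + (1 - s) * g j a = g j (x 0 0).
    by rewrite [RHS]gE// /s; field.
  by rewrite /th mulrC divfK// gt_eqF.
transitivity (\sum_e w0 e * (if e then b else a)); last first.
  apply: eq_bigr => e _; rewrite -[LHS]mulr1 -F1 mulr_sumr; apply: eq_bigr => f _.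
  by rewrite mxE unlift_none /= /w /=; ring.
by rewrite big_bool /= /s; field.
Qed.

Lemma slab_polytope : isrational a -> isrational b ->
  (forall j, isrational (g j a)) -> (forall j, isrational (g j b)) ->
  rational_polytope slab.
Proof.
move=> ra rb rga rgb; exists (range slab_vertex); split; last exact: slab_hull.
  exact: finite_image.
move=> _ [s _ <-].
have /choice[q qE] : forall i, exists q : rat, slab_vertex s 0 i = ratr q.
  move=> i; rewrite mxE; case: unliftP => [j|] _ /=; last by case: s.1.
  have [q qE] : isrational (g j (if s.1 then b else a)) by case: s.1.
  by exists ((s.2 j)%:R * q); rewrite rmorphM /= ratr_nat qE.
by exists (\row_i q i) => //; apply/rowP => i; rewrite [RHS]qE !mxE.
Qed.

(* Together with the points [corner a + frame i *: e_i] of the slab, [corner a]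
   is an affine frame of the whole space. *)
Let corner t : 'rV[R]_N.+1 := t *: delta_mx 0 0.

Let cornerE0 t : corner t 0 0 = t. Proof. by rewrite !mxE mulr1. Qed.
Let cornerE1 t j : corner t 0 (lift ord0 j) = 0.
Proof. by rewrite !mxE mulr0. Qed.

Let frame (j : 'I_N.+1) : R := oapp (fun i => g i a) (b - a) (unlift ord0 j).

Let frame0 i : frame i != 0.
Proof. by rewrite /frame; case: unliftP => [j|] _ //=; rewrite gt_eqF. Qed.

Let slab_corner t : a <= t <= b -> slab (corner t).
Proof.
move=> tab; rewrite /slab /= cornerE0; split=> // j.
by rewrite cornerE1 lexx ltW.
Qed.

Let slab_frame i : slab (corner a + frame i *: row i 1%:M).
Proof.
rewrite /slab /= !mxE mulr1 /frame; case: unliftP => [j|] -> /=.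
  rewrite mulr0 addr0 lexx ltW//; split=> // i'.
  rewrite !mxE mulr0 add0r (inj_eq lift_inj).
  by case: eqVneq => [->|_]; rewrite ?mulr1 ?mulr0 ?lexx (ltW (g0 _ _)) ?lexx.
rewrite mulr1 addrC subrK lexx ltW//; split=> // j.
by rewrite !mxE /= !mulr0 addr0 lexx (ltW (g0 _ _)).
Qed.

Lemma slab_has_dim : has_dim slab N.+1.
Proof.
apply: (has_dim_frame (B := 1%:M) _ (slab_corner _) frame0 slab_frame).
- by rewrite row_free_unit unitmx1.
- by rewrite lexx ltW.
- by move=> x _; exists (x - corner a); rewrite mulmx1 addrC subrK.
Qed.

Lemma slab_affine_span : affine_span slab = setT.
Proof.
rewrite (affine_span_frame (B := 1%:M) (slab_corner _) frame0 slab_frame).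
- apply/seteqP; split=> // x _.
  by exists (x - corner a) => //; rewrite mulmx1 addrC subrK.
- by rewrite lexx ltW.
- by move=> x _; exists (x - corner a); rewrite mulmx1 addrC subrK.
Qed.

Lemma slab_slice_has_dim t : a <= t <= b -> has_dim (slab `&` [set x | x 0 0 = t]) N.
Proof.
move=> tab.
pose B : 'M[R]_(N, N.+1) := \matrix_(i, j) (j == lift ord0 i)%:R.
have BE0 i : B i 0 = 0 by rewrite mxE.
have BE1 i j : B i (lift ord0 j) = (i == j)%:R.
  by rewrite mxE (inj_eq lift_inj) eq_sym.
apply: (@has_dim_frame _ _ _ _ (corner t) B (fun i => g i t)).
- apply/row_freeP; exists B^T; apply/matrixP => i j; rewrite !mxE big_ord_recl.
  rewrite BE0 mul0r add0r (bigD1 i)//= BE1 eqxx mul1r mxE BE1 big1 ?addr0.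
    by rewrite eq_sym.
  by move=> k ki; rewrite BE1 eq_sym (negbTE ki) mul0r.
- by split; [exact: slab_corner|exact: cornerE0].
- by move=> i; rewrite gt_eqF.
- move=> i.
  have E0 : (corner t + g i t *: row i B) 0 0 = t.
    by rewrite mxE cornerE0 !mxE /= mulr0 addr0.
  split=> //; split=> [|j]; rewrite E0//.
  rewrite mxE cornerE1 add0r mxE mxE BE1.
  by case: eqVneq => [->|_]; rewrite ?mulr1 ?mulr0 ?lexx ltW.
- move=> x [_ /= xt]; exists (\row_j x 0 (lift ord0 j)).
  apply/rowP => i; rewrite mxE; case: (unliftP ord0 i) => [j|] ->.
    rewrite cornerE1 add0r mxE (bigD1 j)//= mxE BE1 eqxx mulr1 big1 ?addr0// => k kj.
    by rewrite BE1 (negbTE kj) mulr0.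
  rewrite cornerE0 mxE big1 ?addr0// => k _.
  by rewrite BE0 mulr0.
Qed.

Lemma slab_facet_right : is_facet (slab `&` [set x | x 0 0 = b]) slab.
Proof.
split; last first.
  exists N; split; first exact: slab_has_dim.
  by apply: slab_slice_has_dim; rewrite lexx ltW.
have dE (x : 'rV[R]_N.+1) : \sum_j (delta_mx 0 0 : 'rV[R]_N.+1) 0 j * x 0 j = x 0 0.
  rewrite big_ord_recl mxE mul1r big1 ?addr0// => j _.
  by rewrite mxE mul0r.
exists (delta_mx 0 0), b; split=> [x|]; first by rewrite dE => -[/andP[]].
by congr (_ `&` _); apply/seteqP; split=> x /=; rewrite dE.
Qed.

Lemma slab_facet_left : is_facet (slab `&` [set x | x 0 0 = a]) slab.
Proof.
split; last first.
  exists N; split; first exact: slab_has_dim.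
  by apply: slab_slice_has_dim; rewrite lexx ltW.
have dE (x : 'rV[R]_N.+1) :
    \sum_j (- delta_mx 0 0 : 'rV[R]_N.+1) 0 j * x 0 j = - x 0 0.
  rewrite big_ord_recl !mxE mulN1r big1 ?addr0// => j _.
  by rewrite !mxE oppr0 mul0r.
exists (- delta_mx 0 0), (- a); split=> [x|].
  by rewrite dE lerN2 => -[/andP[]].
congr (_ `&` _); apply/seteqP; split=> x /=; rewrite dE; first by move->.
exact: oppr_inj.
Qed.
End Slab.

(** * Piecewise linear profiles through prescribed nodes *)

Section Clamp.
Variable R : realType.
Implicit Types x : R.

(* The truncation of [x] to [[0, 1]], in a form whose continuity is immediate. *)
Definition clamp x : R := (1 + `|x| - `|1 - x|) / 2.

Lemma clamp_le0 x : x <= 0 -> clamp x = 0.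
Proof.
by move=> x0; rewrite /clamp ler0_norm// ger0_norm ?subr_ge0 ?(le_trans x0)//; field.
Qed.

Lemma clamp_id x : 0 <= x <= 1 -> clamp x = x.
Proof.
by move=> /andP[x0 x1]; rewrite /clamp ger0_norm// ger0_norm ?subr_ge0//; field.
Qed.

Lemma clamp_ge1 x : 1 <= x -> clamp x = 1.
Proof.
move=> x1; rewrite /clamp ger0_norm ?(le_trans _ x1)// ler0_norm ?subr_le0//.
by field.
Qed.

Lemma clamp_continuous : continuous clamp.
Proof.
move=> x; apply: cvgM; last exact: cvg_cst.
apply: cvgB; first by apply: cvgD; [exact: cvg_cst|exact: norm_continuous].
by apply: cvg_norm; apply: cvgB; [exact: cvg_cst|exact: cvg_id].
Qed.
End Clamp.

Section Profile.
Variables (R : realType) (N m : nat) (tau : nat -> R) (h : nat -> 'I_N -> R).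
Hypothesis tau_lt : forall i, (i < m)%N -> tau i < tau i.+1.

(** A sum of ramps, one for the increment over each interval. It is visibly continuous, and constant
    outside the nodes, which keeps it positive on the whole line as [body_homeomorphic] demands. *)
Definition profile j t : R := h 0%N j +
  \sum_(i < m) (h i.+1 j - h i j) * clamp ((t - tau i) / (tau i.+1 - tau i)).

Lemma profile_continuous j : continuous (profile j).
Proof.
move=> t; apply: (@cvgD _ _ _ (nbhs t) (nbhs_filter t)); first exact: cvg_cst.
apply: (@cvg_bigsum _ _ _ (nbhs t) (nbhs_filter t)) => i _.
apply: (@cvgM _ _ (nbhs t) (nbhs_filter t)); first exact: cvg_cst.
apply: (@continuous_comp _ _ _ (fun t => (t - tau i) / (tau i.+1 - tau i)) (@clamp R));
  last exact: clamp_continuous.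
apply: (@cvgM _ _ (nbhs t) (nbhs_filter t)); last exact: cvg_cst.
by apply: (@cvgB _ _ _ (nbhs t) (nbhs_filter t)); [exact: cvg_id|exact: cvg_cst].
Qed.

Lemma tau_le i k : (i <= k <= m)%N -> tau i <= tau k.
Proof.
move=> /andP[ik km]; elim: k ik km => [|k IHk]; first by rewrite leqn0 => /eqP ->.
rewrite leq_eqVlt => /orP[/eqP -> //|ik] km.
by rewrite (le_trans (IHk ik (ltnW km)))// ltW// tau_lt.
Qed.

Lemma tau_locate t : (0 < m)%N -> tau 0%N <= t <= tau m ->
  exists2 i, (i < m)%N & tau i <= t <= tau i.+1.
Proof.
elim: m => // n IHn _ /andP[t0 tn].
have [tn'|tn'] := leP (tau n) t; first by exists n; rewrite ?tn' ?tn.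
case: n IHn tn tn' => [|n] IHn tn tn'; first by rewrite leNgt tn' in t0.
by have [||i im it] := IHn => //; [rewrite t0 ltW|exists i => //; rewrite ltnW].
Qed.

Let telescope j k : (k <= m)%N ->
  \sum_(i < m) (h i.+1 j - h i j) * (i < k)%:R = h k j - h 0%N j.
Proof.
move=> km; rewrite -(telescope_sumr (fun i => h i j))// big_mkord.
rewrite (big_ord_widen m (fun i => h i.+1 j - h i j) km) [RHS]big_mkcond /=.
by apply: eq_bigr => i _; case: ifP => _; rewrite ?mulr1 ?mulr0.
Qed.

(** At [t] the ramps before the [i]-th are complete and the later ones have not begun; by
    [telescope] the complete ones add up to [h i j - h 0 j]. *)
Lemma profileE i j t : (i < m)%N -> tau i <= t <= tau i.+1 ->
  profile j t = h i j + (t - tau i) / (tau i.+1 - tau i) * (h i.+1 j - h i j).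
Proof.
move=> im /andP[ti ti1]; rewrite /profile.
have d0 k : (k < m)%N -> 0 < tau k.+1 - tau k by move=> km; rewrite subr_gt0 tau_lt.
have := telescope j (ltnW im); rewrite (bigD1 (Ordinal im))//= ltnn mulr0 add0r.
move/eqP; rewrite eq_sym subr_eq => /eqP hE.
rewrite (bigD1 (Ordinal im))//= clamp_id; last first.
  by rewrite divr_ge0 ?subr_ge0 ?(ltW (tau_lt im))//= ler_pdivrMr ?d0// mul1r lerD2r.
rewrite [X in _ = X + _]hE addrCA [RHS]addrC [_ / _ * _]mulrC; congr (_ + _).
rewrite addrC; congr (_ + _).
apply: eq_bigr => k; rewrite -val_eqE /= => ki; congr (_ * _).
have [lt|ge] := ltnP k i.
  rewrite clamp_ge1// ler_pdivlMr ?d0// mul1r lerD2r.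
  by apply: le_trans ti; apply: tau_le; rewrite lt ltnW.
have {ge} gt : (i < k)%N by rewrite ltn_neqAle eq_sym ki.
rewrite clamp_le0// pmulr_lle0 ?invr_gt0 ?d0// subr_le0.
by apply: le_trans ti1 _; apply: tau_le; rewrite gt ltnW.
Qed.

Lemma profile_node i j : (0 < m)%N -> (i <= m)%N -> profile j (tau i) = h i j.
Proof.
move=> m0; case: i => [|i] im.
  rewrite (@profileE 0%N)// ?lexx ?(ltW (tau_lt m0))//.
  by rewrite subrr !mul0r addr0.
rewrite (@profileE i)// ?lexx ?(ltW (tau_lt im))// divff.
  by rewrite mul1r addrC subrK.
by rewrite subr_eq0 gt_eqF// tau_lt.
Qed.

Hypothesis h_gt0 : forall i j, (i <= m)%N -> 0 < h i j.
Hypothesis m0 : (0 < m)%N.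

(** The value is [h 0] to the left of the nodes, [h m] to their right, and a convex combination of
    two positive heights in between. *)
Lemma profile_gt0 j t : 0 < profile j t.
Proof.
have d0 k : (k < m)%N -> 0 < tau k.+1 - tau k by move=> km; rewrite subr_gt0 tau_lt.
have [t0|t0] := ltP t (tau 0%N).
  rewrite /profile big1 ?addr0 ?h_gt0// => i _.
  rewrite clamp_le0 ?mulr0// pmulr_lle0 ?invr_gt0 ?d0// subr_le0.
  by apply: le_trans (ltW t0) _; apply: tau_le; rewrite /= ltnW.
have [tm|tm] := leP t (tau m); last first.
  rewrite /profile; under eq_bigr => i _.
    rewrite clamp_ge1; last first.
      rewrite ler_pdivlMr ?d0// mul1r lerD2r.
      by apply: le_trans (ltW tm); apply: tau_le; rewrite ltn_ord leqnn.
    rewrite [X in _ * X](_ : 1 = (i < m)%:R)%R; last by rewrite ltn_ord.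
    over.
  by rewrite telescope// addrC subrK h_gt0.
have [|i im it] := @tau_locate t m0; first by rewrite t0.
rewrite (profileE _ im it).
set s := _ / _.
have /andP[s0 s1] : 0 <= s <= 1.
  have /andP[ti ti1] := it.
  by rewrite divr_ge0 ?subr_ge0 ?(ltW (tau_lt im))//= ler_pdivrMr ?d0// mul1r lerD2r.
have hi := @h_gt0 i j (ltnW im); have hi1 := @h_gt0 i.+1 j im.
have [s_0|s_0] := eqVneq s 0; first by rewrite s_0 mul0r addr0.
rewrite (_ : _ + _ = (1 - s) * h i j + s * h i.+1 j); last by ring.
have {s_0}s_gt0 : 0 < s by rewrite lt_neqAle eq_sym s_0.
apply: ltr_wpDl; last exact: mulr_gt0.
by apply: mulr_ge0; rewrite ?subr_ge0// ltW.
Qed.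

Hypothesis tau0 : tau 0%N = 0.
Hypothesis tau_rat : forall i, (i <= m)%N -> isrational (tau i).
Hypothesis h_rat : forall i j, (i <= m)%N -> isrational (h i j).

Let piece (i : 'I_m) := slab profile (tau i) (tau i.+1).

Let pieceE (i : 'I_m) j t : tau i <= t <= tau i.+1 -> profile j t =
  profile j (tau i) + (t - tau i) / (tau i.+1 - tau i) *
    (profile j (tau i.+1) - profile j (tau i)).
Proof.
move=> it; rewrite (profileE _ (ltn_ord i) it).
by rewrite (profile_node j m0 (ltnW (ltn_ord i))) (profile_node j m0 (ltn_ord i)).
Qed.

(** Pieces that are not consecutive are separated by a nondegenerate interval, so a common point
    forces [k = i.+1]. As the fibres are given by the same profile, the intersection is the full
    slice at [tau k]. *)
Let piece_meet (i k : 'I_m) : (i < k)%N -> piece i `&` piece k !=set0 ->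
  is_facet (piece i `&` piece k) (piece i) /\ is_facet (piece i `&` piece k) (piece k).
Proof.
move=> ik [x [[/andP[_ xi] _] [/andP[kx _] _]]].
have ki : k = i.+1 :> nat.
  apply/eqP; rewrite eqn_leq ik andbT leqNgt; apply/negP => ik1.
  have := le_trans kx xi; apply/negP; rewrite -ltNge.
  apply: lt_le_trans (tau_lt (ltn_trans ik1 (ltn_ord k))) _.
  by apply: tau_le; rewrite ik1 ltnW.
have tki : tau k = tau i.+1 by rewrite ki.
have E1 : piece i `&` piece k = piece i `&` [set y | y 0 0 = tau i.+1].
  apply/seteqP; split=> y [[/andP[iy yi] yj]].
    move=> [/andP[ky yk] _]; split; first by split; rewrite ?iy.
    by apply/eqP; rewrite eq_le yi -tki.
  move=> /= yt; split; split=> //; first by rewrite iy.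
  by rewrite yt -tki lexx (ltW (tau_lt (ltn_ord k))).
have E2 : piece i `&` piece k = piece k `&` [set y | y 0 0 = tau k].
  apply/seteqP; split=> y.
    move=> [[/andP[iy yi] yj] [/andP[ky yk] yj']].
    split; first by split; rewrite ?ky.
    by apply/eqP; rewrite eq_le ky tki yi.
  move=> [[/andP[ky yk] yj]] /= yt; split; split=> //; last by rewrite ky.
  by rewrite yt tki lexx (ltW (tau_lt (ltn_ord i))).
split.
- by rewrite E1; apply: (slab_facet_right profile_gt0 (tau_lt (ltn_ord i))).
- by rewrite E2; apply: (slab_facet_left profile_gt0 (tau_lt (ltn_ord k))).
Qed.

Lemma profile_body_ball :
  rational_polytopal_ball N.+1 (body (tau m) profile).
Proof.
have t_lt (i : 'I_m) : tau i < tau i.+1 by apply: tau_lt.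
split.
  apply: body_homeomorphic; [|exact: profile_gt0|exact: profile_continuous].
  rewrite -tau0; apply: lt_le_trans (tau_lt m0) _.
  by apply: tau_le; rewrite m0 leqnn.
exists m, piece; split.
- apply/seteqP; split=> [x [x0 xj]|x [i _ [/andP[ix xi] xj]]].
    have [|i im it] := @tau_locate (x 0 0) m0; first by rewrite tau0.
    by exists (Ordinal im).
  split=> //; apply/andP; split.
    by apply: le_trans ix; rewrite -tau0; apply: tau_le; rewrite /= ltnW.
  by apply: le_trans xi _; apply: tau_le; rewrite ltn_ord leqnn.
- move=> i; split.
    apply: (slab_polytope profile_gt0 (t_lt i) (@pieceE i)).
    + exact: tau_rat (ltnW (ltn_ord i)).
    + exact: tau_rat (ltn_ord i).
    + by move=> j; rewrite profile_node ?(ltnW (ltn_ord i))//; apply/h_rat/ltnW.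
    + by move=> j; rewrite profile_node ?(ltn_ord i)//; apply: h_rat.
  exact: (slab_has_dim profile_gt0 (t_lt i)).
- by move=> i k; rewrite /piece !slab_affine_span//; apply: profile_gt0.
- move=> i k; rewrite -val_eqE neq_ltn => /orP[ik|ki] ne; first exact: piece_meet.
  rewrite setIC in ne *; by have [] := piece_meet ki ne.
Qed.
End Profile.

(** * The Ehrhart function *)

Section Count.
Variables (R : realType) (N : nat) (T : R) (g : 'I_N -> R -> R).
Hypotheses (T0 : 0 <= T) (g0 : forall j t, 0 <= g j t).

Let bound k j (t : nat) : nat := Num.truncn (k%:R * g j (t%:R / k%:R)).

(** The lattice points are sliced by their first coordinate [t]; each slice is a box and contributes
    a product of floors plus one. *)
Lemma ehrhart_body k : (0 < k)%N -> ehrhart (body T g) k =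
  (\sum_(t < (Num.truncn (k%:R * T)).+1) \prod_j
    (Num.truncn (k%:R * g j (t%:R / k%:R))).+1)%N.
Proof.
move=> k_gt0.
have k0 : 0 < k%:R :> R by rewrite ltr0n.
pose A := (Num.truncn (k%:R * T)).+1.
(* A common strict bound on all fibre coordinates, which places the lattice points in a finite
   type. *)
pose B := (\sum_(t < A) \sum_j bound k j t).+1.
have boundB (t : 'I_A) j : (bound k j t < B)%N.
  by rewrite ltnS (bigD1 t)//= (bigD1 j)//= -addnA leq_addr.
pose D := [set p : 'I_A * {ffun 'I_N -> 'I_B} |
  [forall j, (p.2 j <= bound k j p.1)%N]]%SET.
pose phi (p : 'I_A * {ffun 'I_N -> 'I_B}) : 'rV[int]_N.+1 :=
  \row_i oapp (fun j => (p.2 j : nat)%:Z) (p.1 : nat)%:Z (unlift ord0 i).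
pose psi p : 'rV[R]_N.+1 := map_mx intr (phi p).
have psiE0 p : psi p 0 0 = (p.1 : nat)%:R by rewrite !mxE unlift_none.
have psiE1 p j : psi p 0 (lift ord0 j) = (p.2 j : nat)%:R by rewrite !mxE liftK.
have psi_inj : injective psi.
  move=> p q pq; have e0 := psiE0 p; rewrite pq psiE0 in e0.
  move/eqP: e0; rewrite eqr_nat => /eqP e0.
  case: p q pq e0 => [p1 p2] [q1 q2] pq /= e0; congr (_, _); first exact/val_inj.
  apply/ffunP => j; apply/val_inj; have := psiE1 (p1, p2) j.
  by rewrite pq psiE1 => /eqP; rewrite eqr_nat => /eqP.
have -> : ehrhart (body T g) k = #|D|.
  rewrite /ehrhart cardE -(size_map psi).
  (* An explicit finite set is exhibited, so that [fset_set] can be evaluated. *)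
  rewrite (_ : _ `&` _ = [set` [fset x in [seq psi p | p in D]]%fset]); last first.
    apply/seteqP; split=> [y [[x [/andP[x0 xT] xj] <-] [z _ zE]]|y].
      have zE0 : (z 0 0)%:~R = k%:R * x 0 0 :> R.
        by have /rowP/(_ 0) := zE; rewrite !mxE.
      have zE1 j : (z 0 (lift ord0 j))%:~R = k%:R * x 0 (lift ord0 j) :> R.
        by have /rowP/(_ (lift ord0 j)) := zE; rewrite !mxE.
      have [t tE] : exists t : nat, z 0 0 = t.
        have : (0 : R) <= (z 0 0)%:~R by rewrite zE0 mulr_ge0// ltW.
        by rewrite ler0z; case: (z 0 0) => // t _; exists t.
      have tx : t%:R = k%:R * x 0 0 by rewrite -zE0 tE.
      have xt : x 0 0 = t%:R / k%:R by rewrite tx mulrC mulKf// gt_eqF.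
      have tA : (t < A)%N.
        rewrite ltnS truncn_ge_nat; last by rewrite mulr_ge0// ltW.
        by rewrite tx ler_pM2l.
      have /choice[f fE] : forall j, exists f : 'I_B,
          z 0 (lift ord0 j) = (f : nat) /\ (f <= bound k j t)%N.
        move=> j; have /andP[xj0 xj1] := xj j.
        have : (0 : R) <= (z 0 (lift ord0 j))%:~R by rewrite zE1 mulr_ge0// ltW.
        rewrite ler0z; case zj : (z 0 (lift ord0 j)) => [f|//] _.
        have fb : (f <= bound k j t)%N.
          rewrite truncn_ge_nat; last by rewrite mulr_ge0// ltW.
          have -> : f%:R = k%:R * x 0 (lift ord0 j) by rewrite -zE1 zj.
          by rewrite ler_pM2l// -xt.
        by exists (Ordinal (leq_ltn_trans fb (boundB (Ordinal tA) j))).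
      rewrite /= inE; apply/mapP; exists (Ordinal tA, finfun f).
        by rewrite mem_enum inE; apply/forallP => j; rewrite ffunE; have [] := fE j.
      apply/rowP => i; case: (unliftP ord0 i) => [j|] ->.
        by rewrite psiE1 ffunE mxE -zE1; have [-> _] := fE j.
      by rewrite psiE0 /= mxE tx.
    rewrite /= inE => /mapP[p]; rewrite mem_enum inE => /forallP pD ->.
    split; last by exists (phi p).
    have kk : k%:R *: (k%:R^-1 *: psi p) = psi p.
      by rewrite scalerA divff ?scale1r// gt_eqF.
    exists (k%:R^-1 *: psi p) => //.
    have E i : (k%:R^-1 *: psi p) 0 i = psi p 0 i / k%:R by rewrite mxE mulrC.
    split=> [|j]; rewrite !E psiE0 ?psiE1.
      rewrite divr_ge0 ?(ltW k0)//= ler_pdivrMr// mulrC -truncn_ge_nat.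
        by rewrite -ltnS ltn_ord.
      by rewrite mulr_ge0// ltW.
    rewrite divr_ge0 ?(ltW k0)//= ler_pdivrMr// mulrC -truncn_ge_nat.
      exact: pD.
    by rewrite mulr_ge0// ltW.
  rewrite set_fsetK card_fseq undup_id//.
  by rewrite map_inj_uniq// enum_uniq.
rewrite -sum1_card (eq_bigl (fun p : 'I_A * {ffun 'I_N -> 'I_B} =>
   true && [forall j, (p.2 j <= bound k j p.1)%N])) => [|p]; last by rewrite inE.
rewrite -(pair_big_dep xpredT (fun (t : 'I_A) (f : {ffun 'I_N -> 'I_B}) =>
   [forall j, (f j <= bound k j t)%N]) (fun _ _ => 1%N)) /=.
apply: eq_bigr => t _.
rewrite (eq_bigl (fun f : {ffun 'I_N -> 'I_B} =>
   f \in family (fun j => [pred i : 'I_B | (i <= bound k j t)%N]))) => [|f]; last first.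
  by apply/forallP/familyP => H j; have := H j; rewrite ?inE.
rewrite sum1_card card_family /image_mem foldrE big_map big_enum /=.
apply: eq_bigr => j _; rewrite -sum1_card.
by rewrite -(big_ord_widen B (fun=> 1%N) (boundB t j)) sum_nat_const card_ord muln1.
Qed.
End Count.

(** * The body of a chain and its lattice points *)

Section ChainBody.
Variables (R : realType) (N : nat) (h0 : {ffun 'I_N -> R}).
Variable s : seq (nat * {ffun 'I_N -> R}).

Definition chain_time i : nat := \sum_(r < i) (nth (0%N, h0) s r).1.
Definition chain_height i : {ffun 'I_N -> R} := nth h0 (h0 :: unzip2 s) i.
Definition chain_profile :=
  profile (size s) (fun i => (chain_time i)%:R) (fun i j => chain_height i j).

Hypothesis (s0 : s != [::]) (gh0 : good_height h0).
Hypothesis gs : forall x, x \in s -> (0 < x.1)%N /\ good_height x.2.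

Let length_gt0 i : (i < size s)%N -> (0 < (nth (0%N, h0) s i).1)%N.
Proof. by move=> im; have [] := gs (mem_nth (0%N, h0) im). Qed.

Let timeS i : chain_time i.+1 = (chain_time i + (nth (0%N, h0) s i).1)%N.
Proof. by rewrite /chain_time big_ord_recr. Qed.

Let time_lt i : (i < size s)%N -> (chain_time i)%:R < (chain_time i.+1)%:R :> R.
Proof.
by move=> im; rewrite ltr_nat timeS -[X in (X < _)%N]addn0 ltn_add2l length_gt0.
Qed.

Let time0 : (chain_time 0)%:R = 0 :> R.
Proof. by rewrite /chain_time big_ord0. Qed.

Let size_gt0 : (0 < size s)%N. Proof. by rewrite lt0n size_eq0. Qed.

Let height_good i : (i <= size s)%N -> good_height (chain_height i).
Proof.
case: i => [//|i im]; rewrite /chain_height /= (nth_map (0%N, h0))//.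
by have [] := gs (mem_nth (0%N, h0) im).
Qed.

Lemma chain_body_ball :
  rational_polytopal_ball N.+1 (body (chain_time (size s))%:R chain_profile).
Proof.
apply: (@profile_body_ball _ _ (size s) (fun i => (chain_time i)%:R)
  (fun i j => chain_height i j)) => //.
- by move=> i j im; have [] := height_good im j.
- by move=> i im; exists (chain_time i)%:R; rewrite ratr_nat.
- by move=> i j im; have [] := height_good im j.
Qed.

Let chain_countE k : chain_count h0 s k =
  (\sum_(i < size s)
    block (nth (0%N, h0) s i).1 (chain_height i) (chain_height i.+1) k)%N.
Proof.
rewrite /chain_height; elim: s h0 => [|[l h] s' IHs] h1 /=; first by rewrite big_ord0.
rewrite big_ord_recl /=; congr addn; rewrite IHs; apply: eq_bigr => i _ /=.
have im : (i < size (unzip2 s'))%N by rewrite size_map.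
congr (block _ _ _ _); first by rewrite (set_nth_default (0%N, h1)).
  by apply: set_nth_default; rewrite /= size_map ltnS ltnW.
exact: set_nth_default.
Qed.

Lemma ehrhart_chain_body k : (0 < k)%N ->
  ehrhart (body (chain_time (size s))%:R chain_profile) k =
  (chain_count h0 s k + \prod_j (Num.truncn (k%:R * last h0 (unzip2 s) j)).+1)%N.
Proof.
move=> k_gt0; have k0 : k%:R != 0 :> R by rewrite pnatr_eq0 -lt0n.
rewrite ehrhart_body//; last first.
  move=> j t; apply/ltW/profile_gt0 => //.
  by move=> i j' im; have [] := height_good im j'.
(* The dilated width is an integer, so a slice lies exactly at its end; this closing slice belongs
   to no [block] and is split off. *)
rewrite -natrM natrK big_ord_recr /=; congr addn; last first.
  apply: eq_bigr => j _; congr (Num.truncn _).+1; rewrite natrM mulrAC divff// mul1r.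
  rewrite /chain_profile profile_node// /chain_height -(size_map snd).
  by rewrite -[size _]/((size (h0 :: unzip2 s)).-1) nth_last.
rewrite chain_countE.
suff H i : (i <= size s)%N -> (\sum_(t < k * chain_time i)
    \prod_j (Num.truncn (k%:R * chain_profile j (t%:R / k%:R))).+1 =
  \sum_(r < i) block (nth (0%N, h0) s r).1 (chain_height r) (chain_height r.+1) k)%N.
  exact: H.
elim: i => [|i IHi] im; first by rewrite /chain_time big_ord0 muln0 !big_ord0.
(* In the dilate, step [i] of length [l] consists of the slices [t = k * chain_time i + u] with
   [u < k * l]. *)
rewrite timeS mulnDr big_split_ord big_ord_recr /= IHi ?(ltnW im)//; congr addn.
apply: eq_bigr => u _; apply: eq_bigr => j _; congr (Num.truncn _).+1.
have l0 := length_gt0 im.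
have lR : (nth (0%N, h0) s i).1%:R != 0 :> R by rewrite pnatr_eq0 -lt0n.
rewrite /chain_profile (@profileE _ _ _ _ _ _ i)//.
  by rewrite timeS !natrD natrM; field; rewrite k0 lR.
have kp : 0 < k%:R :> R by rewrite ltr0n.
rewrite ler_pdivlMr// ler_pdivrMr// -!natrM !ler_nat mulnC leq_addr /=.
by rewrite timeS [leqRHS]mulnC mulnDr leq_add2l ltnW// ltn_ord.
Qed.
End ChainBody.

Lemma linked_ball (R : realType) (r : nat) (phi : nat -> rat) : loop R r phi ->
  exists Q : set 'rV[R]_r.+2, rational_polytopal_ball r.+2 Q /\
    exists q : {poly rat}, (size q <= r.+3)%N /\
      forall k, (0 < k)%N -> (ehrhart Q k)%:R = q.[k%:R] + phi k.
Proof.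
move=> lphi.
have [s [s0 gs ls [q [sq qE]]]] := lphi.
have gones : good_height (ones R r).
  move=> j; rewrite /ones /node ffunE; case: (unlift ord0 j) => [i|] /=;
    (split; [exact: ltr01|exact: one_rat]).
exists (body (chain_time (ones R r) s (size s))%:R (chain_profile (ones R r) s)).
split; first exact: chain_body_ball.
(* The closing slice is a unit cube, with [(k + 1)^(r + 1)] lattice points in the [k]-th dilate. *)
have [q1 [sq1 q1E]] : polyfun r.+1 (fun k => (k%:R + 1) ^+ r.+1).
  have := @polyfun_prod r.+1 (fun _ k => k%:R + 1)
    (fun=> polyfunD polyfun_id (polyfun_cst 1 1)).
  by apply: polyfun_ext => k; rewrite prodr_const card_ord.
exists (q + q1); split=> [|k k0].
  by rewrite (leq_trans (size_polyD _ _))// geq_max sq (leq_trans sq1).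
rewrite ehrhart_chain_body// natrD hornerD -qE -q1E addrAC subrK; congr (_ + _).
rewrite ls /ones (@node_nat R r 1) natr_prod.
rewrite -[in RHS](card_ord r.+1) -prodr_const; apply: eq_bigr => j _.

rewrite ffunE (_ : oapp _ _ _ = 1%N); last by case: unlift.
by rewrite mulr1 natrK natr1.
Qed.

(** Without fibre coordinates the body is its base interval, here [[0, 1/p]]. *)
Lemma segment_ball (R : realType) (p : nat) : (0 < p)%N ->
  exists Q : set 'rV[R]_1, rational_polytopal_ball 1 Q /\
    forall k, (0 < k)%N -> ehrhart Q k = (1 + k %/ p)%N.
Proof.
move=> p0; have pR : 0 < p%:R :> R by rewrite ltr0n.
pose tau i : R := i%:R / p%:R; pose h (i : nat) (j : 'I_0) : R := 1.
have tau_lt i : (i < 1)%N -> tau i < tau i.+1.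
  by move=> _; rewrite ltr_pM2r ?invr_gt0// ltr_nat.
exists (body (tau 1%N) (profile 1 tau h)); split.
  apply: profile_body_ball => //; first by rewrite /tau mul0r.
    by move=> i _; exists (i%:R / p%:R); rewrite fmorph_div !rmorph_nat.
  by move=> i [].
move=> k k0; rewrite ehrhart_body ?divr_ge0 ?ler0n//; last by case.
under eq_bigr do rewrite big_ord0.
rewrite sum_nat_const card_ord muln1 /tau mul1r -[k%:R / _]add0r.
by rewrite (@truncn_natDdiv R 0%N).
Qed.

(** * Coefficient functions and their minimal periods *)

Section Coefficients.
Variables (R : realType) (n : nat) (Q : set 'rV[R]_n) (p : 'I_n -> nat).
Hypothesis p_gt0 : forall i, (0 < p i)%N.
Variable q : {poly rat}.
Hypothesis sq : (size q <= n.+1)%N.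
Hypothesis qE : forall k, (0 < k)%N ->
  (ehrhart Q k)%:R = q.[k%:R] + \sum_(i < n) k%:R ^+ i * (k %/ p i)%:R.

(* [frac d z] is the fractional part of [z / d]; [lead] absorbs the terms
   [k / p i] of the floors [k %/ p i = k / p i - frac (p i) k]. *)
Let frac (d : nat) (z : int) : rat := (z %% d%:Z)%Z%:~R / d%:R.

Let lead := q + \sum_(i < n) (p i)%:R^-1 *: 'X^(i.+1).

(** At [i = n] the [insub] fails, which makes the leading coefficient constant. *)
Let c (i : 'I_n.+1) (z : int) : rat :=
  lead`_i - oapp (fun j => frac (p j) z) 0 (insub (i : nat) : option 'I_n).

Let size_lead : (size lead <= n.+1)%N.
Proof.
rewrite (leq_trans (size_polyD _ _))// geq_max sq /=.
apply: leq_trans (size_sum _ _ _) _; apply/bigmax_leqP => i _.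
by rewrite (leq_trans (size_scale_leq _ _))// size_polyXn ltnS ltn_ord.
Qed.

Let frac_periodic d : periodic (frac d) d%:Z.
Proof. by move=> z; rewrite /frac modzDr. Qed.

Let frac_nat d k : (0 < d)%N -> (k %/ d)%:R = k%:R / d%:R - frac d k%:Z.
Proof.
move=> d0; have dR : d%:R != 0 :> rat by rewrite pnatr_eq0 -lt0n.
have kE : k%:R = (k %/ d)%:R * d%:R + (k %% d)%:R :> rat.
  by rewrite -natrM -natrD -divn_eq.
by rewrite /frac modz_nat -mulrBl kE addrK mulfK.
Qed.

Lemma floor_coefficients : exists c : 'I_n.+1 -> int -> rat,
  ehrhart_coefficients Q c /\
  forall i : 'I_n, min_period (c (widen_ord (leqnSn n) i)) (p i).
Proof.
have cE i z : c (widen_ord (leqnSn n) i) z = lead`_i - frac (p i) z.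
  by rewrite /c /= (valK i).
have per i : periodic (c (widen_ord (leqnSn n) i)) (p i)%:Z.
  by move=> z; rewrite !cE frac_periodic.
exists c; split; last first.
  (* A period [d] is tested at 0, where the fractional part vanishes: it vanishes at [d] too, so
     [p i] divides [d]. *)
  move=> i; split=> // d d0 /(_ 0); rewrite !cE add0r => /(addrI _)/oppr_inj.
  rewrite /frac mod0z mul0r => /eqP; rewrite mulf_eq0 invr_eq0 pnatr_eq0.
  rewrite [p i == 0]gtn_eqF// orbF intr_eq0 modz_nat eqz_nat => dvd.
  by apply: dvdn_leq.
split=> [i|k k0].
  case: (unliftP ord_max i) => [j|] ->; last first.
    exists 1%N => // z; rewrite /c /= insubF//.
    by rewrite ltnn.
  exists (p j) => //; have -> : lift ord_max j = widen_ord (leqnSn n) j.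
    by apply: val_inj; rewrite /= /bump leqNgt ltn_ord.
  exact: per.
rewrite qE// big_ord_recr /= {2}/c insubF ?ltnn//= subr0.
under [in RHS]eq_bigr do rewrite cE mulrBl.
rewrite sumrB addrAC.
have -> : \sum_(i < n) lead`_i * k%:R ^+ i + lead`_n * k%:R ^+ n = lead.[k%:R].
  by rewrite (horner_coef_wide _ size_lead) big_ord_recr.
rewrite hornerD horner_sum -addrA -sumrB; congr (_ + _); apply: eq_bigr => i _.
by rewrite hornerZ hornerXn frac_nat// exprS; ring.
Qed.
End Coefficients.

Theorem theorem2 (R : realType) (n : nat) (n_gt0 : (0 < n)%N)
    (p : 'I_n -> nat) (p_gt0 : forall i : 'I_n, (0 < p i)%N) :
  exists Q : set 'rV[R]_n,
    rational_polytopal_ball n Q /\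
    exists c : 'I_n.+1 -> int -> rat,
      ehrhart_coefficients Q c /\
      forall i : 'I_n, min_period (c (widen_ord (leqnSn n) i)) (p i).
Proof.
case: n n_gt0 p p_gt0 => // -[|r] _ p p_gt0.
  have [Q [ballQ ehrQ]] := segment_ball R (p_gt0 0).
  (* The polynomial part is the constant 1, which counts the origin. *)
  exists Q; split=> //; apply: (@floor_coefficients _ _ _ p p_gt0 1) => [|k k0].
    by rewrite size_poly1.
  by rewrite ehrQ// big_ord1 expr0 mul1r hornerE natrD.
(* In dimension [r.+2], one loop for each coefficient, all concatenated at the unit box. *)
have floor_loop : loop R r (fun k => \sum_(i < r.+2) k%:R ^+ i * (k %/ p i)%:R).
  apply: loop_sum => i; apply: loop_exp_floor => //.
  by rewrite -ltnS ltn_ord.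
have [Q [ballQ [q [sq qE]]]] := linked_ball floor_loop.
by exists Q; split=> //; apply: floor_coefficients sq qE.
Qed.
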